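(* Let $(\mathbb{R}^n,g)$ be a pseudo-Euclidean space, $n\geq 3$, with coordinates $x=(x_1,\dots,x_n)$ and $g_{ij}=\delta_{ij}\varepsilon_i$, $\varepsilon_i\in\{1,-1\}$, and let $(F^m,g_F)$, $m\geq 1$, be a Ricci-flat semi-Riemannian manifold. Let $\xi=\sum_{i=1}^n\alpha_ix_i$, where $\alpha_i\in\mathbb{R}$ are not all zero and $\sum_{i=1}^n\varepsilon_i\alpha_i^2=0$, and let $f(\xi)$ be any positive smooth function of $\xi\in\mathbb{R}$. Then there exists a nowhere vanishing smooth function $\varphi(\xi)$ satisfying $$(n-2)f\varphi''-m\varphi f''-2m\varphi'f'=0$$ (primes denoting derivatives with respect to $\xi$), and the warped product $M=(\mathbb{R}^n,\overline g)\times_fF^m$, with $\overline g=\frac1{\varphi^2}g$, is a Ricci-flat manifold.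
   Context: For semi-Riemannian manifolds $(B,g_B)$, $(F,g_F)$ and a smooth function $f>0$ on $B$, the warped product $B\times_fF$ is the product manifold $B\times F$ with the metric $g_B+f^2g_F$ (pullbacks by the projections being understood). Ricci-flat means that the Ricci tensor vanishes identically; when $m=1$ the fiber is $F=\mathbb{R}$, which is Ricci-flat. Functions of $\xi$ are regarded as functions on $\mathbb{R}^n$ by composition with $x\mapsto\sum_i\alpha_ix_i$. *)

(* Defs.v *)
From HB Require Import structures.
From mathcomp Require Import all_boot all_order all_algebra.
From mathcomp Require Import all_classical all_reals all_analysis.
Set Implicit Arguments.
Unset Strict Implicit.
Unset Printing Implicit Defensive.
Import Order.TTheory GRing.Theory Num.Theory.
Import numFieldNormedType.Exports.
Local Open Scope ring_scope.
Local Open Scope classical_set_scope.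

Definition partial (R : realType) (d : nat) (f : 'rV[R]_d -> R) (i : 'I_d)
    (x : 'rV[R]_d) : R :=
  derive f x (delta_mx 0 i).

(* f is of class C^k at the points of U; meant for U open. *)
Fixpoint class_on (R : realType) (d k : nat) (U : set 'rV[R]_d)
    (f : 'rV[R]_d -> R) : Prop :=
  (forall x, U x -> {for x, continuous f}) /\
  match k with
  | 0%N => True
  | k'.+1 => forall i : 'I_d,
      (forall x, U x -> derivable f x (delta_mx 0 i)) /\
      class_on k' U (partial f i)
  end.

Definition smooth_on (R : realType) (d : nat) (U : set 'rV[R]_d)
    (f : 'rV[R]_d -> R) : Prop :=
  forall k : nat, class_on k U f.

Definition smooth_map_on (R : realType) (d e : nat) (U : set 'rV[R]_d)
    (h : 'rV[R]_d -> 'rV[R]_e) : Prop :=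
  forall j : 'I_e, smooth_on U (fun x => h x 0 j).

Definition smooth_real (R : realType) (f : R -> R) : Prop :=
  forall (k : nat) (t : R), derivable (f^`(k)) t 1.

(* A topological space with an atlas. The map [chart_inv a] is the inverse of
   [chart_map a : chart_dom a -> 'rV_d]; the values of [chart_map a] outside
   [chart_dom a], and of [chart_inv a] outside [chart_map a @` chart_dom a], are
   irrelevant. *)
Record charted_space (R : realType) (d : nat) := ChartedSpace {
  carrier : topologicalType;
  chart : Type;
  chart_dom : chart -> set carrier;
  chart_map : chart -> carrier -> 'rV[R]_d;
  chart_inv : chart -> 'rV[R]_d -> carrier }.

Definition chart_image (R : realType) (d : nat) (M : charted_space R d)
    (a : chart M) : set 'rV[R]_d :=
  chart_map a @` chart_dom a.

Definition overlap (R : realType) (d : nat) (M : charted_space R d)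
    (a b : chart M) : set 'rV[R]_d :=
  chart_map a @` (chart_dom a `&` chart_dom b).

Definition transition (R : realType) (d : nat) (M : charted_space R d)
    (a b : chart M) (x : 'rV[R]_d) : 'rV[R]_d :=
  chart_map b (chart_inv a x).

Record smooth_manifold (R : realType) (d : nat) (M : charted_space R d) : Prop :=
  SmoothManifold {
  manifold_hausdorff : hausdorff_space (carrier M);
  manifold_countable : @second_countable (carrier M);
  chart_dom_open : forall a : chart M, open (chart_dom a);
  chart_dom_cover : forall p : carrier M, exists a : chart M, chart_dom a p;
  chart_image_open : forall a : chart M, open (chart_image a);
  chart_mapK : forall (a : chart M) p, chart_dom a p ->
    chart_inv a (chart_map a p) = p;
  chart_map_continuous : forall (a : chart M) p, chart_dom a p ->
    {for p, continuous (chart_map a)};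
  chart_inv_continuous : forall (a : chart M) x, chart_image a x ->
    {for x, continuous (chart_inv a)};
  transition_smooth : forall a b : chart M,
    smooth_map_on (overlap a b) (transition a b) }.

(* A (0,2)-tensor field, given by its component matrices in the charts:
   [g a x] is the matrix of the components at the point [chart_inv a x]. *)
Definition tensor02 (R : realType) (d : nat) (M : charted_space R d) : Type :=
  chart M -> 'rV[R]_d -> 'M[R]_d.

(* Entry (i, j) is the i-th partial derivative of the j-th component of h. *)
Definition jacobian_mx (R : realType) (d e : nat) (h : 'rV[R]_d -> 'rV[R]_e)
    (x : 'rV[R]_d) : 'M[R]_(d, e) :=
  \matrix_(i, j) partial (fun y => h y 0 j) i x.

(* The rows of W span a k-dimensional subspace on which the form is negative
   definite (this forces W to be row free). *)
Definition negative_definite_on (R : realType) (d k : nat) (G : 'M[R]_d)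
    (W : 'M[R]_(k, d)) : Prop :=
  forall u : 'rV[R]_k, u != 0 ->
    ((u *m W) *m G *m (u *m W)^T) 0 0 < 0.

Definition has_index (R : realType) (d : nat) (G : 'M[R]_d) (nu : nat) : Prop :=
  (exists W : 'M[R]_(nu, d), negative_definite_on G W) /\
  (forall (k : nat) (W : 'M[R]_(k, d)), negative_definite_on G W -> (k <= nu)%N).

Record semi_riemannian (R : realType) (d : nat) (M : charted_space R d)
    (g : tensor02 M) : Prop := SemiRiemannian {
  metric_manifold : smooth_manifold M;
  metric_tensor : forall (a b : chart M) x, overlap a b x ->
    g a x = jacobian_mx (transition a b) x *m g b (transition a b x)
            *m (jacobian_mx (transition a b) x)^T;
  metric_smooth : forall (a : chart M) (i j : 'I_d),
    smooth_on (chart_image a) (fun x => g a x i j);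
  metric_sym : forall (a : chart M) x, chart_image a x -> (g a x)^T = g a x;
  metric_nondegenerate : forall (a : chart M) x, chart_image a x ->
    g a x \in unitmx;
  metric_index : exists nu : nat, forall (a : chart M) x, chart_image a x ->
    has_index (g a x) nu }.

(* christoffel G k i j is Gamma^k_{ij}. *)
Definition christoffel (R : realType) (d : nat) (G : 'rV[R]_d -> 'M[R]_d)
    (k i j : 'I_d) (x : 'rV[R]_d) : R :=
  2^-1 * \sum_(l < d) invmx (G x) k l *
    (partial (fun y => G y j l) i x + partial (fun y => G y i l) j x
     - partial (fun y => G y i j) l x).

(* riemann G l k i j is the component R^l_{kij}, where
   R(d_i, d_j) d_k = R^l_{kij} d_l
   and R(X, Y) = [nabla_X, nabla_Y] - nabla_[X, Y]. *)
Definition riemann (R : realType) (d : nat) (G : 'rV[R]_d -> 'M[R]_d)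
    (l k i j : 'I_d) (x : 'rV[R]_d) : R :=
  partial (christoffel G l j k) i x - partial (christoffel G l i k) j x
  + \sum_(p < d) (christoffel G p j k x * christoffel G l i p x
                  - christoffel G p i k x * christoffel G l j p x).

Definition ricci (R : realType) (d : nat) (G : 'rV[R]_d -> 'M[R]_d)
    (j k : 'I_d) (x : 'rV[R]_d) : R :=
  \sum_(i < d) riemann G i k i j x.

Definition ricci_flat (R : realType) (d : nat) (M : charted_space R d)
    (g : tensor02 M) : Prop :=
  forall (a : chart M) x, chart_image a x ->
    forall i j : 'I_d, ricci (g a) i j x = 0.

Definition euclidean_space (R : realType) (n : nat) : charted_space R n :=
  @ChartedSpace R n 'rV[R]_n unit (fun=> setT) (fun=> id) (fun=> id).

Definition pseudo_euclidean (R : realType) (n : nat) (eps : 'I_n -> R) :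
    tensor02 (euclidean_space R n) :=
  fun _ _ => \matrix_(i, j) ((i == j)%:R * eps i).

(* The tensor field h * g, for a function h on M. *)
Definition scale_metric (R : realType) (d : nat) (M : charted_space R d)
    (h : carrier M -> R) (g : tensor02 M) : tensor02 M :=
  fun a x => h (chart_inv a x) *: g a x.

Definition product_space (R : realType) (n m : nat) (B : charted_space R n)
    (F : charted_space R m) : charted_space R (n + m) :=
  @ChartedSpace R (n + m) (carrier B * carrier F)%type (chart B * chart F)%type
    (fun ab => chart_dom ab.1 `*` chart_dom ab.2)
    (fun ab p => row_mx (chart_map ab.1 p.1) (chart_map ab.2 p.2))
    (fun ab x => (chart_inv ab.1 (lsubmx x), chart_inv ab.2 (rsubmx x))).

(* The metric g_B + f^2 g_F on the product. *)
Definition warped_metric (R : realType) (n m : nat) (B : charted_space R n)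
    (gB : tensor02 B) (f : carrier B -> R) (F : charted_space R m)
    (gF : tensor02 F) : tensor02 (product_space B F) :=
  fun ab x =>
    block_mx (gB ab.1 (lsubmx x)) 0
             0 (f (chart_inv ab.1 (lsubmx x)) ^+ 2 *: gF ab.2 (rsubmx x)).

Definition linear_form (R : realType) (n : nat) (alpha : 'I_n -> R)
    (x : 'rV[R]_n) : R :=
  \sum_(i < n) alpha i * x 0 i.

(* Main.v *)
Require Import Defs.
From mathcomp Require Import all_boot all_order all_algebra.
From mathcomp Require Import all_classical all_reals all_analysis.
From mathcomp Require Import ring lra zify.
Import Order.TTheory GRing.Theory Num.Theory.
Import numFieldNormedType.Exports.
Local Open Scope ring_scope.
Local Open Scope classical_set_scope.

(** Let a = m / (n - 2) and h = f' / f.  Writing phi = f^a psi turns the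
    differential equation for phi into psi'' = (a^2 + a) h^2 psi.  The potential
    is nonnegative, so the solution with psi(0) = 1 and psi'(0) = 0 is convex
    with its minimum at 0: it stays >= 1, and phi never vanishes
    ([conformal_factor_exists]).  The solution on the whole line is the limit of
    the iterates S_(k+1)'' = q S_k ([linear_ode_ge1]).  A convex function with
    vanishing derivative at 0 is minimal there ([convex_ge0]); comparing with
    cosh (lam t) therefore bounds the increments of the iterates by
    2^-k cosh (lam t) on any bounded interval.

    The curvature of the warped product is computed in product charts.  There
    the metric is u(xi) diag(eps) + w(xi) g_F with u = 1 / phi^2 and w = f^2.
    With p = u' / (2 u), q = w' / (2 w), r = w' / (2 u) and beta_k = eps_k alpha_k,
    and indices i, j, k on the base and a, b, c on the fiber, the nonzero
    Christoffel symbols are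
      Gamma^k_ij = p (alpha_i d_jk + alpha_j d_ik - eps_i d_ij beta_k),
      Gamma^k_ab = - r beta_k (g_F)_ab,
      Gamma^c_ib = Gamma^c_bi = q alpha_i d_cb
    and the symbols Gamma^c_ab of g_F.  Since xi is a null coordinate,
    sum_k alpha_k beta_k = 0; this kills the mixed terms of Ric_ab, and those of
    Ric_ia cancel in pairs.  What is left is Ric_ab = Ric(g_F)_ab = 0, Ric_ia = Ric_ai = 0 and
      Ric_jk = alpha_j alpha_k ((2 - n) p' - m q' + 2 p (n p + m q)
                                - (n + 2) p^2 - m q^2).
    As p = - phi' / phi and q = f' / f, the parenthesis is
    ((n - 2) f phi'' - m phi f'' - 2 m phi' f') / (phi f), which is 0
    ([ricci_flat_warped]).

    That the warped metric is semi-Riemannian holds for every warped product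
    ([warped_semi_riemannian]).  Besides the product manifold structure this
    needs the index of a block diagonal form to be the sum of the indices of the
    blocks ([has_index_block]). *)

(** * Primitives and comparison of convex functions *)

Lemma is_derive_continuous {R : realType} (F : R -> R) (t l : R) :
  is_derive t 1 F l -> {for t, continuous F}.
Proof.
move=> [dF _]; apply: differentiable_continuous; exact/derivable1_diffP.
Qed.

Lemma ge0_derive_le {R : realType} (F F1 : R -> R) (a b : R) :
  a <= b -> (forall t : R, is_derive t 1 F (F1 t)) ->
  (forall t, a <= t <= b -> 0 <= F1 t) -> F a <= F b.
Proof.
move=> ab dF F1ge0.
have [|c cab E] := @MVT_segment R F F1 a b ab (fun x _ => dF x).
  by apply: continuous_subspaceT => t; exact: is_derive_continuous.
by rewrite -subr_ge0 E mulr_ge0 ?subr_ge0// F1ge0// -in_itv.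
Qed.

Lemma eq_derive_at0 {R : realType} (F G h : R -> R) (a b : R) :
  (forall t : R, a < t < b -> is_derive t 1 F (h t)) ->
  (forall t : R, a < t < b -> is_derive t 1 G (h t)) ->
  a < 0 < b -> F 0 = G 0 -> forall t, a < t < b -> F t = G t.
Proof.
move=> dF dG ab0 FG0 t tab.
have key (x y : R) : a < x < b -> a < y < b -> x <= y ->
    F y - F x = G y - G x.
  move=> xab yab xy.
  have dD z : a < z < b -> is_derive z 1 (F - G) 0.
    move=> zab; have d1 := dF z zab; have d2 := dG z zab.
    by apply: is_derive_eq; rewrite subrr.
  have [z||c _] := @MVT_segment R (F - G) (cst 0) x y xy.
  - rewrite in_itv/= => /andP[xz zy]; apply: dD; lra.
  - apply: derivable_within_continuous => z; rewrite in_itv/= => /andP[xz zy].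
    by have [] := dD z ltac:(lra).
  rewrite mul0r /= => /eqP; rewrite subr_eq0 => /eqP E.
  have : F y - G y = F x - G x by exact: E.
  lra.
have [t0|/ltW t0] := leP 0 t; have := key _ _ _ _ t0; rewrite ab0 tab.
  by move=> /(_ isT isT); lra.
by move=> /(_ isT isT); lra.
Qed.

(** The left end -1 of the integral makes 0 an interior point, so that two such
    primitives, one of them reflected, overlap around 0 and can be glued. *)
Lemma right_primitive {R : realType} (g : R -> R) : continuous g ->
  exists G : R -> R, (forall t : R, -1 < t -> is_derive t 1 G (g t)) /\ G 0 = 0.
Proof.
move=> cg; pose F (x : R) : R := (\int[lebesgue_measure]_(t in `[(-1)%R, x]) g t)%R.
exists (fun x => F x - F 0); rewrite subrr; split=> // t t1.
suff dF : is_derive t 1 F (g t).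
  have dC := is_derive_cst (F 0) t 1.
  by have := is_deriveB dF dC; rewrite subr0.
have tu : t < t + 1 by rewrite ltrDl.
have gi : lebesgue_measure.-integrable `[(-1)%R, t + 1] (EFin \o g).
  apply: continuous_compact_integrable; first exact: segment_compact.
  exact: continuous_subspaceT.
have [dF FE] := continuous_FTC1_closed tu gi t1 (cg t).
by apply: DeriveDef; [exact: dF|rewrite -derive1E; exact: FE].
Qed.

Lemma primitive_exists {R : realType} (g : R -> R) : continuous g ->
  exists G : R -> R, (forall t : R, is_derive t 1 G (g t)) /\ G 0 = 0.
Proof.
move=> cg; have [P [dP P0]] := right_primitive _ cg.
have cg' : continuous (fun t : R => g (- t)).
  move=> t; apply: (@continuous_comp _ _ _ -%R g); [exact: opp_continuous|exact: cg].
have [Q [dQ Q0]] := right_primitive _ cg'.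
pose N t := - Q (- t).
have dN (t : R) : t < 1 -> is_derive t 1 N (g t).
  move=> t1.
  have dQt : is_derive (- t) 1 Q (g t) by rewrite -[in g _](opprK t); apply: dQ; lra.
  have dopp : is_derive t 1 (-%R : R -> R) (-1) by apply: is_derive_eq.
  have := is_deriveN (is_derive1_comp dQt dopp).
  by rewrite mulrN1 opprK.
have PN : forall t, -1 < t < 1 -> P t = N t.
  apply: (@eq_derive_at0 R P N g).
  - by move=> t /andP[? _]; exact: dP.
  - by move=> t /andP[_ ?]; exact: dN.
  - by rewrite ltr01 ltrN10.
  - by rewrite /N oppr0 Q0 P0 oppr0.
exists (fun t => if 0 <= t then P t else N t); rewrite lexx; split=> // t.
have [t0|t0] := ltP t 0.
  apply: (@near_eq_is_derive _ _ _ N).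
    near=> s; rewrite leNgt ifF//; apply/negbF.
    by near: s; exact: lt_nbhsl.
  by apply: dN; lra.
apply: (@near_eq_is_derive _ _ _ P); last by apply: dP; lra.
near=> s; case: ifPn => //; rewrite -ltNge => s0; apply: PN; rewrite (lt_trans s0)// andbT.
near: s; apply: lt_nbhsr; lra.
Unshelve. all: by end_near. Qed.

(** [F1] has the sign of its argument because it vanishes at 0 and is
    nondecreasing; hence 0 is the minimum of [F].  All estimates of the iterates
    of the differential equation reduce to this. *)
Lemma convex_ge0 {R : realType} (F F1 F2 : R -> R) (T : R) :
  (forall t : R, is_derive t 1 F (F1 t)) ->
  (forall t : R, is_derive t 1 F1 (F2 t)) ->
  F1 0 = 0 -> (forall t, `|t| <= T -> 0 <= F2 t) ->
  forall t, `|t| <= T -> F 0 <= F t.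
Proof.
move=> dF dF1 F10 F2ge0 t; rewrite ler_norml => /andP[Tt tT].
have [t0|/ltW t0] := leP 0 t.
  apply: (ge0_derive_le _ _ _ _ t0 dF) => s /andP[s0 st].
  rewrite -F10; apply: (ge0_derive_le _ _ _ _ s0 dF1) => r /andP[r0 rs].
  by apply: F2ge0; rewrite ler_norml; lra.
have dNF (s : R) : is_derive s 1 (- F) (- F1 s) by exact: is_deriveN.
have := ge0_derive_le _ _ _ _ t0 dNF; rewrite lerN2; apply=> s /andP[ts s0].
rewrite oppr_ge0 -F10; apply: (ge0_derive_le _ _ _ _ s0 dF1) => r /andP[sr r0].
by apply: F2ge0; rewrite ler_norml; lra.
Qed.

Lemma second_primitive {R : realType} (k : R -> R) (c : R) : continuous k ->
  exists W W1 : R -> R, [/\ forall t : R, is_derive t 1 W (W1 t),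
    forall t : R, is_derive t 1 W1 (k t), W 0 = c & W1 0 = 0].
Proof.
move=> ck; have [W1 [dW1 W10]] := primitive_exists _ ck.
have [|W [dW W0]] := primitive_exists W1.
  by move=> t; exact: is_derive_continuous.
exists (fun t => W t + c), W1; split=> //; last by rewrite W0 add0r.
by move=> t; have dC := is_derive_cst c t 1; have := is_deriveD (dW t) dC; rewrite addr0.
Qed.

(** The eigenfunction of the second derivative used as a comparison function:
    for [lam] large it absorbs any bounded potential. *)
Definition cosh {R : realType} (lam t : R) : R :=
  (expR (lam * t) + expR (- (lam * t))) / 2.

Lemma cosh_ge1 {R : realType} (lam t : R) : 1 <= cosh lam t.
Proof.
have := @expR_ge1Dx R (lam * t); have := @expR_ge1Dx R (- (lam * t)).
rewrite /cosh; lra.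
Qed.

Lemma derive_cosh {R : realType} (lam : R) : exists C1 : R -> R,
  [/\ forall t : R, is_derive t 1 (cosh lam) (C1 t),
    forall t : R, is_derive t 1 C1 (lam ^+ 2 * cosh lam t) & C1 0 = 0].
Proof.
have dl (c t : R) : is_derive t 1 (fun t : R => expR (c * t)) (c * expR (c * t)).
  have d : is_derive t 1 (fun t : R => c * t) c.
    by have := is_deriveZ c (is_derive_id t 1); rewrite scaler1.
  have := is_derive1_comp (is_derive_expR (c * t)) d.
  by rewrite mulrC.
exists (fun t => lam / 2 * expR (lam * t) - lam / 2 * expR (- lam * t)).
split=> [t|t|]; last by rewrite !mulr0 subrr.
- rewrite /cosh; under eq_fun do rewrite -mulNr.
  have d := is_deriveD (is_deriveZ (2^-1 : R) (dl lam t)) (is_deriveZ (2^-1 : R) (dl (- lam) t)).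
  rewrite (_ : (fun x => _) = 2^-1 *: (fun t : R => expR (lam * t)) + 2^-1 *: (fun t : R => expR (- lam * t))).
    by apply: is_derive_eq; rewrite /GRing.scale/=; ring.
  by apply/funext => x /=; rewrite !fctE /GRing.scale/=; ring.
- have d := is_deriveD (is_deriveZ (lam / 2 : R) (dl lam t)) (is_deriveZ (- (lam / 2) : R) (dl (- lam) t)).
  rewrite (_ : (fun x => _) = (lam / 2) *: (fun t : R => expR (lam * t)) + (- (lam / 2)) *: (fun t : R => expR (- lam * t))).
    by apply: is_derive_eq; rewrite /GRing.scale/= /cosh -(mulNr lam t); field.
  by apply/funext => x /=; rewrite !fctE /GRing.scale/=; ring.
Qed.

(** Since n <= 2^n, the archimedean property suffices. *)
Lemma le0_halving {R : realType} (x K : R) :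
  0 <= K -> (forall n, x <= 2^-1 ^+ n * K) -> x <= 0.
Proof.
move=> K0 xK; rewrite leNgt; apply/negP => x0.
have := archi_boundP (divr_ge0 K0 (ltW x0)); set n := Num.bound _ => Kn.
have n2 : n%:R <= 2 ^+ n :> R by rewrite -natrX ler_nat ltnW// ltn_expl.
have := xK n; rewrite exprVn ler_pdivlMl ?exprn_gt0//.
rewrite ltr_pdivrMr// in Kn; apply/negP; rewrite -ltNge.
by apply: lt_le_trans Kn _; rewrite ler_wpM2r// ltW.
Qed.

(** Both bounds are [convex_ge0], for [D] and for [c * cosh lam - D]. *)
Lemma cosh_compare {R : realType} (D D1 k : R -> R) (lam T c : R) :
  (forall t : R, is_derive t 1 D (D1 t)) ->
  (forall t : R, is_derive t 1 D1 (k t)) ->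
  D1 0 = 0 -> 0 <= D 0 <= c ->
  (forall t, `|t| <= T -> 0 <= k t <= c * (lam ^+ 2 * cosh lam t)) ->
  forall t, `|t| <= T -> 0 <= D t <= c * cosh lam t.
Proof.
move=> dD dD1 D10 /andP[D0ge0 D0c] kb t tT; apply/andP; split.
  by apply: le_trans D0ge0 (convex_ge0 _ _ _ _ dD dD1 D10 _ _ tT) => s /kb/andP[].
have [C1 [dC dC1 C10]] := derive_cosh lam.
have dF s := is_deriveB (is_deriveZ c (dC s)) (dD s).
have dF1 s := is_deriveB (is_deriveZ c (dC1 s)) (dD1 s).
have := convex_ge0 _ _ _ T dF dF1 _ _ t tT.
rewrite /GRing.scale/= C10 D10 mulr0 subrr => /(_ erefl) H.
rewrite -subr_ge0; apply: le_trans (H _); last first.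
  by move=> s /kb/andP[_]; rewrite -subr_ge0.
rewrite subr_ge0 (le_trans D0c)// ler_peMr ?cosh_ge1//; exact: le_trans D0c.
Qed.

(** Picard iteration S_(k+1)'' = q S_k, S_(k+1) (0) = 1, S_(k+1)' (0) = 0, from
    S_0 = 0.  On |t| <= T choose [lam] with 2 q <= lam^2: each step halves the
    bound on the increments, so 0 <= S_(k+1) - S_k <= 2^-k cosh (lam t).  The
    limit [psi] is locally uniform, and the solution [W] of W'' = q psi differs
    from S_(k+1) by O(2^-k), whence W = psi. *)
Theorem linear_ode_ge1 {R : realType} (q : R -> R) :
  continuous q -> (forall t, 0 <= q t) ->
  exists psi psi1 : R -> R, [/\ forall t : R, is_derive t 1 psi (psi1 t),
    forall t : R, is_derive t 1 psi1 (q t * psi t) & forall t, 1 <= psi t].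
Proof.
move=> cq q0.
have cqM (S : R -> R) : continuous S -> continuous (fun t => q t * S t).
  by move=> cS t; apply: cvgM; [exact: cq|exact: cS].
(* For a discontinuous [S] the iterate is arbitrary. *)
have /choice[step stepP] : forall S : R -> R, exists W : R -> R, continuous S ->
    exists W1 : R -> R, [/\ forall t : R, is_derive t 1 W (W1 t),
      forall t : R, is_derive t 1 W1 (q t * S t), W 0 = 1 & W1 0 = 0].
  move=> S; have [cS|ncS] := pselect (continuous S); last by exists S.
  have [W [W1 WP]] := second_primitive _ 1 (cqM _ cS).
  by exists W => _; exists W1.
pose S n := iter n step (cst 0).
have cS n : continuous (S n).
  elim: n => [|n IHn] t; first exact: cst_continuous.
  by have [W1 [dW _ _ _]] := stepP _ IHn; exact: is_derive_continuous (dW t).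
have bound T : exists lam : R, forall t, `|t| <= T -> 2 * q t <= lam ^+ 2.
  have [T0|T0] := leP 0 T; last by exists 0 => t; have := normr_ge0 t; lra.
  have [||c _ cmax] := @EVT_max R q (- T) T; first by lra.
    exact: continuous_subspaceT.
  (* (1 + x)^2 >= x for x = 2 q(c), where q(c) is the maximum of q. *)
  exists (1 + 2 * q c) => t; rewrite ler_norml => /cmax qc.
  have := q0 c; nra.
have Sstep T lam : (forall t, `|t| <= T -> 2 * q t <= lam ^+ 2) ->
    forall n t, `|t| <= T -> 0 <= S n.+1 t - S n t <= 2^-1 ^+ n * cosh lam t.
  move=> qlam; elim=> [|n IHn].
    have [W1 [dW dW1 W0 W10]] := stepP _ (cS 0%N).
    move=> t tT; rewrite expr0 subr0.
    apply: cosh_compare dW dW1 W10 _ _ _ tT; first by rewrite W0 ler01 lexx.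
    move=> s _; rewrite mulr0 lexx/= mul1r mulr_ge0 ?sqr_ge0//.
    exact: le_trans (cosh_ge1 _ _).
  have [W1 [dW dW1 W0 W10]] := stepP _ (cS n).
  have [V1 [dV dV1 V0 V10]] := stepP _ (cS n.+1).
  move=> t tT.
  have dD s := is_deriveB (dV s) (dW s).
  have dD1 s := is_deriveB (dV1 s) (dW1 s).
  apply: cosh_compare dD dD1 _ _ _ _ tT.
  - by rewrite W10 V10 subrr.
  - by rewrite !fctE V0 W0 subrr lexx exprn_ge0// invr_ge0.
  move=> s sT; have /andP[d0 dn] := IHn s sT; rewrite -mulrBr mulr_ge0//=.
  apply: le_trans (ler_wpM2l (q0 s) dn) _.
  have C0 : 0 <= cosh lam s by exact: le_trans (cosh_ge1 _ _).
  rewrite exprS [leLHS](_ : _ = 2^-1 * 2^-1 ^+ n * (2 * q s * cosh lam s)); last by field.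
  by rewrite ler_wpM2l ?mulr_ge0 ?exprn_ge0 ?invr_ge0// ler_wpM2r// qlam.
have Smono n m t : (n <= m)%N -> S n t <= S m t.
  apply: (nondecreasing_seqP (S ^~ t)).1 => i; have [lam qlam] := bound `|t|.
  by have /andP[+ _] := Sstep _ _ qlam i t (lexx _); rewrite subr_ge0.
have Stail T lam : (forall t, `|t| <= T -> 2 * q t <= lam ^+ 2) ->
    forall n m t, `|t| <= T -> S m t <= S n t + 2 * 2^-1 ^+ n * cosh lam t.
  move=> qlam n m t tT.
  have C0 : 0 <= cosh lam t by exact: le_trans (cosh_ge1 _ _).
  have [mn|/ltnW nm] := leqP m n.
    rewrite (le_trans (Smono _ _ t mn))// lerDl !mulr_ge0 ?exprn_ge0 ?invr_ge0//.
  (* Adding the bound on the whole tail makes the sequence nonincreasing. *)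
  pose a i := S i t + 2 * 2^-1 ^+ i * cosh lam t.
  have am : a m <= a n.
    apply: (nonincreasing_seqP a).1 nm => i; have /andP[_] := Sstep _ _ qlam i t tT.
    rewrite /a exprS; lra.
  apply: le_trans am; rewrite /a lerDl !mulr_ge0 ?exprn_ge0 ?invr_ge0//.
pose psi t := sup (range (S ^~ t)).
have psi_sup t : has_sup (range (S ^~ t)).
  split; first by exists (S 0%N t), 0%N.
  have [lam qlam] := bound `|t|.
  by exists (S 0%N t + 2 * 2^-1 ^+ 0 * cosh lam t) => _ [m _ <-]; exact: Stail qlam _ _ _ _.
have psi_ge n t : S n t <= psi t.
  by apply: ub_le_sup; [case: (psi_sup t)|exists n].
have psi_le T lam : (forall t, `|t| <= T -> 2 * q t <= lam ^+ 2) ->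
    forall n t, `|t| <= T -> psi t <= S n t + 2 * 2^-1 ^+ n * cosh lam t.
  move=> qlam n t tT; apply: ge_sup; first by case: (psi_sup t).
  by move=> _ [m _ <-]; exact: Stail qlam _ _ _ tT.
have cpsi : continuous psi.
  move=> t0; have [lam qlam] := bound (`|t0| + 1).
  apply/cvgrPdist_le => e e0.
  have [C1 [dC _ _]] := derive_cosh lam.
  have Cc := is_derive_continuous _ _ _ (dC t0).
  have C0 t : 0 <= cosh lam t by exact: le_trans (cosh_ge1 _ _).
  have [n nP] : exists n : nat, 2^-1 ^+ n * (2 * (cosh lam t0 + 1)) <= e / 3.
    apply: contrapT => /forallNP nP.
    have := @le0_halving R (e / 3) (2 * (cosh lam t0 + 1)).
    move=> H; suff : e / 3 <= 0 by lra.
    apply: H; first by have := C0 t0; lra.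
    by move=> n; rewrite ltW// ltNge; exact/negP/nP.
  have Scn := cS n t0; move/cvgrPdist_le in Scn.
  move/cvgrPdist_le in Cc.
  have Idc : s @[s --> t0] --> t0 by exact: cvg_id.
  move/cvgrPdist_le in Idc.
  near=> t.
  have h1 : `|S n t0 - S n t| <= e / 3 by near: t; apply: Scn; lra.
  have h2 : `|cosh lam t0 - cosh lam t| <= 1 by near: t; exact: Cc.
  have h3 : `|t - t0| <= 1.
    by rewrite distrC; near: t; exact: Idc.
  have tT : `|t| <= `|t0| + 1.
    by rewrite -(subrK t0 t) (le_trans (ler_normD _ _))// addrC lerD2l.
  have t0T : `|t0| <= `|t0| + 1 by rewrite lerDl.
  have a1 := psi_le _ _ qlam n t tT; have a2 := psi_le _ _ qlam n t0 t0T.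
  have b1 := psi_ge n t; have b2 := psi_ge n t0.
  move: (nP) a1 a2; set h := 2^-1 ^+ n => hP a1 a2; have h0 : 0 <= h by rewrite exprn_ge0// invr_ge0.
  move: h1 h2; rewrite !ler_norml => /andP[? ?] /andP[? ?].
  have : h * cosh lam t <= h * (cosh lam t0 + 1) by rewrite ler_wpM2l//; lra.
  have : 0 <= h * 1 by rewrite mulr1.
  by move=> ? ?; apply/andP; split; lra.
have [W [W1 [dW dW1 W0 W10]]] := second_primitive _ 1 (cqM _ cpsi).
have Wpsi : W = psi.
  apply/funext => t; have [lam qlam] := bound `|t|.
  have C0 s : 0 <= cosh lam s by exact: le_trans (cosh_ge1 _ _).
  suff : `|W t - psi t| <= 0 by rewrite normr_le0 subr_eq0 => /eqP.
  apply: (@le0_halving _ _ (2 * cosh lam t)); first by rewrite mulr_ge0.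
  move=> n; have [V1 [dV dV1 V0 V10]] := stepP _ (cS n).
  have dD s := is_deriveB (dW s) (dV s).
  have dD1 s := is_deriveB (dW1 s) (dV1 s).
  have h0 : 0 <= 2^-1 ^+ n :> R by rewrite exprn_ge0// invr_ge0.
  have /andP[] : 0 <= (W - S n.+1) t <= 2^-1 ^+ n * cosh lam t.
    apply: cosh_compare dD dD1 _ _ _ _ (lexx _).
    - by rewrite W10 V10 subrr.
    - by rewrite !fctE W0 V0 subrr lexx.
    move=> s sT; rewrite -mulrBr mulr_ge0 ?subr_ge0//=.
    have pl := psi_le _ _ qlam n s sT; have ql := qlam s sT.
    apply: (@le_trans _ _ (q s * (2 * 2^-1 ^+ n * cosh lam s))).
      by rewrite ler_wpM2l//; lra.
    rewrite [leLHS](_ : _ = 2^-1 ^+ n * (2 * q s * cosh lam s)); last by ring.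
    by rewrite ler_wpM2l// ler_wpM2r.
  have := psi_ge n.+1 t; have := psi_le _ _ qlam n.+1 t (lexx _).
  rewrite exprS !fctE ler_norml; set C := cosh _ _; set h := 2^-1 ^+ n.
  have : 0 <= h * C by apply: mulr_ge0; [exact: h0|exact: C0].
  by move=> ? ? ? ? ?; apply/andP; split; lra.
exists W, W1; split=> [//|t|t]; first by rewrite Wpsi.
rewrite -W0; apply: (convex_ge0 _ _ _ _ dW dW1 W10 _ _ (lexx _)) => s _.
by rewrite mulr_ge0// (psi_ge 0%N).
Unshelve. all: by end_near. Qed.

(** * The conformal factor *)

(** Being differentiable k + 1 times, by recursion on the derivative: this form
    lets closure properties and differential equations be treated by induction
    on k. *)
Fixpoint derivable_upto {R : realType} (k : nat) (f : R -> R) : Prop :=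
  (forall t, derivable f t 1) /\
  if k is k'.+1 then derivable_upto k' f^`()%classic else True.

Lemma smooth_realP {R : realType} (f : R -> R) :
  smooth_real f <-> forall k, derivable_upto k f.
Proof.
split=> [sf k|sf k t].
  elim: k f sf => [|k IHk] f sf /=; first by split=> // t; exact: (sf 0%N).
  split; first by move=> t; exact: (sf 0%N).
  by apply: IHk => j t; rewrite -derive1Sn; exact: sf.
have := sf k; elim: k f {sf} => [|k IHk] f [df dk]; first exact: df.
by rewrite derive1Sn; exact: IHk.
Qed.

Lemma derivable_uptoW {R : realType} k (f : R -> R) :
  derivable_upto k.+1 f -> derivable_upto k f.
Proof.
by elim: k f => [|k IHk] f [df dk]; split=> //; exact: IHk.
Qed.

Lemma is_derive_derive1 {R : realType} (f f1 : R -> R) :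
  (forall t : R, is_derive t 1 f (f1 t)) -> f^`()%classic = f1.
Proof. by move=> df; apply/funext => t; rewrite derive1E; apply: derive_val. Qed.

Lemma derivable_is_derive {R : realType} (f : R -> R) (t : R) :
  derivable f t 1 -> is_derive t 1 f (f^`()%classic t).
Proof. by move=> df; rewrite derive1E; exact: derivableP. Qed.

Lemma derivable_uptoS {R : realType} k (f f1 : R -> R) :
  (forall t : R, is_derive t 1 f (f1 t)) -> derivable_upto k f1 ->
  derivable_upto k.+1 f.
Proof.
move=> df dk /=; rewrite (is_derive_derive1 _ _ df); split=> // t; case: (df t).
Qed.

Lemma derivable_upto0 {R : realType} (f f1 : R -> R) :
  (forall t : R, is_derive t 1 f (f1 t)) -> derivable_upto 0 f.
Proof. by move=> df; split=> // t; have [] := df t. Qed.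

Lemma derivable_upto_cst {R : realType} k (c : R) : derivable_upto k (cst c).
Proof.
elim: k c => [|k IHk] c.
  by apply: derivable_upto0 => t; exact: is_derive_cst.
by apply: derivable_uptoS (IHk 0) => t; exact: is_derive_cst.
Qed.

Lemma derivable_uptoD {R : realType} k (f g : R -> R) :
  derivable_upto k f -> derivable_upto k g -> derivable_upto k (f + g).
Proof.
elim: k f g => [|k IHk] f g [df dfk] [dg dgk].
  by split=> [t|//]; apply: derivableD; [exact: df|exact: dg].
apply: derivable_uptoS (IHk _ _ dfk dgk) => t.
exact: is_deriveD (derivable_is_derive _ _ (df t)) (derivable_is_derive _ _ (dg t)).
Qed.

Lemma derivable_uptoM {R : realType} k (f g : R -> R) :
  derivable_upto k f -> derivable_upto k g -> derivable_upto k (f * g).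
Proof.
elim: k f g => [|k IHk] f g Hf Hg; have [df dfk] := Hf; have [dg dgk] := Hg.
  by split=> [t|//]; apply: derivableM; [exact: df|exact: dg].
apply: (@derivable_uptoS _ _ _ (f * g^`()%classic + g * f^`()%classic)).
  move=> t.
  exact: is_deriveM (derivable_is_derive _ _ (df t)) (derivable_is_derive _ _ (dg t)).
by apply: derivable_uptoD; apply: IHk => //; exact: derivable_uptoW.
Qed.

Lemma smooth_real_derive1 {R : realType} (f : R -> R) :
  smooth_real f -> smooth_real f^`()%classic.
Proof. by move=> sf k t; rewrite -derive1Sn; exact: sf. Qed.

Lemma smooth_real_is_derive {R : realType} (f : R -> R) (t : R) :
  smooth_real f -> is_derive t 1 f (f^`()%classic t).
Proof. by move=> sf; apply: derivable_is_derive; exact: (sf 0%N). Qed.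

Lemma smooth_realM {R : realType} (f g : R -> R) :
  smooth_real f -> smooth_real g -> smooth_real (f * g).
Proof.
by rewrite !smooth_realP => sf sg k; exact: derivable_uptoM.
Qed.

(** Bootstrapping: if [g] is k times differentiable, so is its derivative. *)
Lemma smooth_real_log_derive {R : realType} (g c : R -> R) : smooth_real c ->
  (forall t : R, is_derive t 1 g (c t * g t)) -> smooth_real g.
Proof.
rewrite !smooth_realP => sc dg; elim=> [|k IHk]; first exact: derivable_upto0 dg.
by apply: derivable_uptoS dg _; exact: derivable_uptoM.
Qed.

Lemma is_derive_invr {R : realType} (g : R -> R) : smooth_real g -> (forall t, 0 < g t) ->
  forall t : R, is_derive t 1 (fun s => (g s)^-1) (- g^`()%classic t / g t ^+ 2).
Proof.
move=> sg g0 t; have [dg E] := smooth_real_is_derive g t sg.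
apply: DeriveDef; first by apply: derivableV dg; rewrite gt_eqF.
rewrite deriveV; [|by rewrite gt_eqF|exact: dg].
by rewrite E /GRing.scale/= !mulNr mulrC.
Qed.

Lemma smooth_real_inv {R : realType} (f : R -> R) : smooth_real f ->
  (forall t, 0 < f t) -> smooth_real (fun t => (f t)^-1).
Proof.
move=> sf f0; have dinv := is_derive_invr f sf f0.
move: sf (smooth_real_derive1 _ sf); rewrite !smooth_realP => sf sf1.
elim=> [|k IHk]; first exact: derivable_upto0 dinv.
apply: derivable_uptoS dinv _.
rewrite (_ : (fun t => _) = cst (-1) * (fun t => (f t)^-1) * (fun t => (f t)^-1) * f^`()%classic).
  have c1 : derivable_upto k (cst (-1 : R)) by exact: derivable_upto_cst.
  have v2 := derivable_uptoM _ _ _ (derivable_uptoM _ _ _ c1 IHk) IHk.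
  exact: derivable_uptoM _ _ _ v2 (sf1 k).
by apply/funext => t; rewrite !fctE -exprVn expr2; ring.
Qed.

Lemma derive1_log {R : realType} (g : R -> R) (t : R) :
  smooth_real g -> (forall t, 0 < g t) ->
  (fun s => g^`()%classic s / g s)^`()%classic t =
  g^`(2)%classic t / g t - (g^`()%classic t / g t) ^+ 2.
Proof.
move=> sg g0; rewrite derive1E.
have d1 := smooth_real_is_derive _ t (smooth_real_derive1 _ sg).
have d := is_deriveM d1 (is_derive_invr g sg g0 t).
have [_ E] := d; rewrite (_ : (fun s => _) = g^`()%classic * (fun s => (g s)^-1))// E.
rewrite derive1nS derive1n1 /GRing.scale/=.
by field; rewrite gt_eqF.
Qed.

Lemma derive1_invsq {R : realType} (g : R -> R) : smooth_real g -> (forall t, 0 < g t) ->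
  (fun t => 1 / g t ^+ 2)^`()%classic = fun t => - 2 * g^`()%classic t / g t ^+ 3.
Proof.
move=> sg g0; rewrite (_ : (fun t => _) = (fun s => (g s)^-1) * (fun s => (g s)^-1)); last first.
  by apply/funext => t; rewrite !fctE div1r -expr2 exprVn.
apply: is_derive_derive1 => t.
have d := is_deriveM (is_derive_invr g sg g0 t) (is_derive_invr g sg g0 t).
apply: (is_derive_eq d); rewrite /GRing.scale/=.
by field; rewrite gt_eqF.
Qed.

Lemma derive1_sq {R : realType} (g : R -> R) : smooth_real g ->
  (fun t => g t ^+ 2)^`()%classic = fun t => 2 * g t * g^`()%classic t.
Proof.
move=> sg; rewrite (_ : (fun t => _) = g * g); last by apply/funext => t; rewrite !fctE expr2.
apply: is_derive_derive1 => t.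
have dg := smooth_real_is_derive _ t sg.
apply: (is_derive_eq (is_deriveM dg dg)); rewrite /GRing.scale/=; ring.
Qed.

(** The factor f^a, with a = m / L, removes the first-order term: with
    h = f' / f, the equation for phi = f^a psi becomes
    psi'' = (a^2 + a) h^2 psi, whose potential is nonnegative. *)
Theorem conformal_factor_exists {R : realType} (f : R -> R) (L m : R) :
  smooth_real f -> (forall t, 0 < f t) -> 0 < L -> 0 <= m ->
  exists phi : R -> R, [/\ smooth_real phi, forall t, 0 < phi t &
    forall t, L * f t * phi^`(2)%classic t - m * phi t * f^`(2)%classic t
              - 2 * m * phi^`()%classic t * f^`()%classic t = 0].
Proof.
move=> sf f0 L0 m0; pose a := m / L.
have a0 : 0 <= a by rewrite divr_ge0// ltW.
have fn0 t : f t != 0 by rewrite gt_eqF.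
pose h := f^`()%classic * (fun t => (f t)^-1).
have sh : smooth_real h.
  by apply: smooth_realM; [exact: smooth_real_derive1|exact: smooth_real_inv].
have hE t : f^`()%classic t = f t * h t by rewrite /h !fctE mulrCA divff// mulr1.
have scst (c : R) : smooth_real (cst c).
  by rewrite smooth_realP => k; exact: derivable_upto_cst.
pose q := cst (a ^+ 2 + a) * (h * h).
have sq : smooth_real q by apply: (smooth_realM _ _ (scst _) (smooth_realM _ _ sh sh)).
have [psi [psi1 [dpsi dpsi1 psi_ge1]]] : exists psi psi1 : R -> R,
    [/\ forall t : R, is_derive t 1 psi (psi1 t),
    forall t : R, is_derive t 1 psi1 (q t * psi t) & forall t, 1 <= psi t].
  apply: linear_ode_ge1 => t.
    exact: is_derive_continuous (smooth_real_is_derive _ _ sq).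
  by rewrite /q !fctE mulr_ge0 ?addr_ge0 ?sqr_ge0// -expr2 sqr_ge0.
pose g t := f t `^ a.
have dg (t : R) : is_derive t 1 g (a * h t * g t).
  have := is_derive1_comp (is_derive1_powR a (f0 t)) (smooth_real_is_derive _ t sf).
  set d := (X in is_derive _ _ _ X); suff -> : d = a * h t * g t by [].
  rewrite /d /g /powR !gt_eqF// hE mulrBl mul1r expRB lnK ?posrE//.
  by field.
have sg : smooth_real g.
  by exact: (@smooth_real_log_derive _ _ (cst a * h) (smooth_realM _ _ (scst a) sh)).
have spsi : smooth_real psi.
  move: sq; rewrite !smooth_realP => sq.
  suff H k : derivable_upto k psi /\ derivable_upto k psi1 by move=> k; case: (H k).
  elim: k => [|k [IH IH1]].
    by split; [exact: derivable_upto0 dpsi|exact: derivable_upto0 dpsi1].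
  split; first exact: derivable_uptoS dpsi IH1.
  by apply: derivable_uptoS dpsi1 _; exact: derivable_uptoM.
exists (g * psi); split; first exact: (smooth_realM _ _ sg spsi).
  by move=> t; rewrite !fctE mulr_gt0 ?powR_gt0// (lt_le_trans ltr01).
have dphi t := is_deriveM (dg t) (dpsi t).
have phi1E : (g * psi)^`()%classic = fun t => g t * psi1 t + a * h t * g t * psi t.
  by apply: is_derive_derive1 => t; have := dphi t; rewrite /GRing.scale/= (mulrC (psi t)).
have dh t := smooth_real_is_derive _ t sh.
have phi2E : (g * psi)^`(2)%classic = fun t => g t * (q t * psi t) + 2 * a * h t * g t * psi1 t +
    a * h^`()%classic t * g t * psi t + a ^+ 2 * h t ^+ 2 * g t * psi t.
  rewrite derive1nS derive1n1 phi1E; apply: is_derive_derive1 => t.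
  have d1 := is_deriveM (dg t) (dpsi1 t).
  have d2 := is_deriveM (is_deriveM (is_deriveZ a (dh t)) (dg t)) (dpsi t).
  have := is_deriveD d1 d2.
  set d := (X in is_derive _ _ _ X) => H.
  have ringE (G P P1 H1 H2 Q : R) : G * (Q * P) + P1 * (a * H1 * G) +
      (a * H1 * G * P1 + P * (a * H1 * (a * H1 * G) + G * (a * H2))) =
      G * (Q * P) + 2 * a * H1 * G * P1 + a * H2 * G * P + a ^+ 2 * H1 ^+ 2 * G * P.
    by ring.
  apply: (is_derive_eq H); exact: ringE.
have f2E : f^`(2)%classic = fun t => f t * (h^`()%classic t + h t ^+ 2).
  rewrite derive1nS derive1n1 (_ : f^`()%classic = f * h); last by apply/funext => t; rewrite hE.
  apply: is_derive_derive1 => t.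
  apply: (is_derive_eq (is_deriveM (smooth_real_is_derive _ t sf) (dh t))).
  rewrite /GRing.scale/= hE; ring.
move=> t; rewrite phi1E phi2E f2E hE /q !fctE /a.
by field; rewrite gt_eqF.
Qed.

(** * The index of a symmetric matrix *)

Definition qform {R : realType} {d : nat} (G : 'M[R]_d) (v : 'rV[R]_d) : R :=
  (v *m G *m v^T) 0 0.

Lemma qform0 {R : realType} {d} (G : 'M[R]_d) : qform G 0 = 0.
Proof. by rewrite /qform !mul0mx mxE. Qed.

Lemma qformZ {R : realType} {d} (G : 'M[R]_d) c v :
  qform G (c *: v) = c ^+ 2 * qform G v.
Proof. by rewrite /qform linearZ -!scalemxAl -scalemxAr !mxE; ring. Qed.

Lemma qform_block {R : realType} {n m} (A : 'M[R]_n) (B : 'M[R]_m) v w :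
  qform (block_mx A 0 0 B) (row_mx v w) = qform A v + qform B w.
Proof.
by rewrite /qform mul_row_block !mulmx0 addr0 add0r tr_row_mx mul_row_col mxE.
Qed.

Lemma qformD_ortho {R : realType} {d} (G : 'M[R]_d) v w :
  G^T = G -> w *m G *m v^T = 0 -> qform G (v + w) = qform G v + qform G w.
Proof.
move=> GT wv; have vw : v *m G *m w^T = 0.
  by apply: trmx_inj; rewrite !trmx_mul trmxK GT mulmxA wv trmx0.
by rewrite /qform !mulmxDl linearD/= !mulmxDr wv vw addr0 add0r mxE.
Qed.

(** A vector of the left kernel of [W] would give the value 0. *)
Lemma negative_definite_row_free {R : realType} {d k} (G : 'M[R]_d)
  (W : 'M[R]_(k, d)) : negative_definite_on G W -> row_free W.
Proof.
move=> Wneg; rewrite -kermx_eq0; apply/rowV0P => u /sub_kermxP uW.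
by apply: contraPeq isT => /Wneg; rewrite uW !mul0mx mxE ltxx.
Qed.

Lemma has_index_exists {R : realType} {d} (G : 'M[R]_d) : exists nu, has_index G nu.
Proof.
pose P k := `[< exists W : 'M[R]_(k, d), negative_definite_on G W >].
have P0 : exists k, P k.
  by exists 0%N; apply/asboolP; exists 0 => u; rewrite thinmx0 eqxx.
have Pd k : P k -> (k <= d)%N.
  by move=> /asboolP[W /negative_definite_row_free/eqP <-]; exact: rank_leq_col.
case: (ex_maxnP P0 Pd) => nu /asboolP[W Wneg] numax.
exists nu; split; first by exists W.
by move=> k V Vneg; apply: numax; apply/asboolP; exists V.
Qed.

Lemma has_index_scale {R : realType} {d} (G : 'M[R]_d) (c : R) nu :
  0 < c -> has_index G nu -> has_index (c *: G) nu.
Proof.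
move=> c0 [[W Wneg] numax].
have scaleE k (V : 'M[R]_(k, d)) u :
    ((u *m V) *m (c *: G) *m (u *m V)^T) 0 0 =
    c * ((u *m V) *m G *m (u *m V)^T) 0 0.
  by rewrite -scalemxAr -scalemxAl mxE.
split.
  by exists W => u u0; rewrite scaleE pmulr_rlt0// Wneg.
move=> k V Vneg; apply: (numax k V) => u u0.
by have := Vneg u u0; rewrite scaleE pmulr_rlt0.
Qed.

(** The orthogonal complement of a negative definite subspace of maximal
    dimension [nu]: a vector of it on which the form is negative could be added
    to that subspace. *)
Lemma nonneg_complement {R : realType} {d} (G : 'M[R]_d) nu :
  G^T = G -> has_index G nu ->
  exists P : 'M[R]_d, (d <= nu + \rank P)%N /\
    forall v : 'rV[R]_d, (v <= P)%MS -> 0 <= qform G v.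
Proof.
(* The row space of this kernel is the orthogonal complement of [W]. *)
move=> GT [[W Wneg] numax]; exists (kermx (G *m W^T)); split.
  rewrite mxrank_ker; have := rank_leq_col (G *m W^T).
  have := rank_leq_row (G *m W^T); lia.
move=> v /sub_kermxP; rewrite mulmxA => vW; rewrite leNgt; apply/negP => vneg.
suff /numax : negative_definite_on G (col_mx W v) by rewrite addn1 ltnn.
move=> u u0; rewrite -[u]hsubmxK mul_row_col.
set a := lsubmx u; set b := rsubmx u.
have bE : b = (b 0 0)%:M by rewrite [LHS]mx11_scalar.
rewrite bE mul_scalar_mx -/(qform _ _) qformD_ortho//; last first.
  by rewrite -!scalemxAl trmx_mul mulmxA vW mul0mx scaler0.
rewrite qformZ.
have [a0|a0] := eqVneq a 0.
  have b0 : b 0 0 != 0.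
    apply: contra_neq u0 => b0.
    by rewrite -[u]hsubmxK -/a -/b a0 bE b0 raddf0 row_mx0.
  by rewrite a0 mul0mx qform0 add0r pmulr_rlt0// exprn_even_gt0.
by rewrite -[ltRHS]addr0 ltr_leD ?Wneg// mulr_ge0_le0 ?sqr_ge0// ltW.
Qed.

(** Sylvester's argument: the sum of the nonnegative complements of the two
    blocks has codimension at most [nu + mu] and meets a negative definite
    subspace only in 0. *)
Lemma has_index_block {R : realType} {n m} (A : 'M[R]_n) (B : 'M[R]_m) nu mu :
  A^T = A -> B^T = B -> has_index A nu -> has_index B mu ->
  has_index (block_mx A 0 0 B) (nu + mu).
Proof.
move=> AT BT iA iB; split.
  have [[V Vneg] _] := iA; have [[W Wneg] _] := iB.
  exists (block_mx V 0 0 W) => u u0.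
  rewrite -/(qform _ _) -[u]hsubmxK mul_row_block !mulmx0 addr0 add0r qform_block.
  have [a0|a0] := eqVneq (lsubmx u) 0; have [b0|b0] := eqVneq (rsubmx u) 0.
  - by move: u0; rewrite -[u]hsubmxK a0 b0 row_mx0 eqxx.
  - by rewrite a0 mul0mx qform0 add0r; exact: Wneg.
  - by rewrite b0 mul0mx qform0 addr0; exact: Vneg.
  - by rewrite -[ltRHS]addr0 ltrD//; [exact: Vneg|exact: Wneg].
move=> k W Wneg.
have [P [rP Ppos]] := nonneg_complement _ _ AT iA.
have [Q [rQ Qpos]] := nonneg_complement _ _ BT iB.
pose PQ := block_mx P 0 0 Q.
have rPQ : (\rank PQ = \rank P + \rank Q)%N by rewrite rank_diag_block_mx.
have disj : (W :&: PQ)%MS = 0.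
  apply/eqP/rowV0P => v; rewrite sub_capmx => /andP[/submxP[u uE] /submxP[w wE]].
  have vpos : 0 <= qform (block_mx A 0 0 B) v.
    rewrite wE /PQ -[w]hsubmxK mul_row_block !mulmx0 addr0 add0r qform_block.
    by rewrite addr_ge0// ?Ppos ?Qpos// submxMl.
  have [u0|u0] := eqVneq u 0; first by rewrite uE u0 mul0mx.
  by have := Wneg u u0; rewrite -/(qform _ _) -uE ltNge vpos.
have := mxrank_disjoint_sum disj; have := rank_leq_col (W + PQ)%MS.
have /eqP -> := negative_definite_row_free _ _ Wneg.
rewrite rPQ; lia.
Qed.

(** * Functions of class C^k on open sets *)

Lemma class_onW {R : realType} {d k} (U : set 'rV[R]_d) f :
  class_on k.+1 U f -> class_on k U f.
Proof.
elim: k f => [|k IHk] f [cf df]; split=> // i.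
by have [dfi dk] := df i; split=> //; exact: IHk.
Qed.

Lemma partial_ext {R : realType} {d} (U : set 'rV[R]_d) f g i x :
  open U -> (forall y, U y -> f y = g y) -> U x ->
  partial f i x = partial g i x.
Proof.
move=> oU fg Ux; apply: near_eq_derive.
by apply: filterS (open_nbhs_nbhs (conj oU Ux)) => y /fg.
Qed.

Lemma continuous_at_ext {R : realType} {d} (U : set 'rV[R]_d) (f g : 'rV[R]_d -> R) x :
  open U -> (forall y, U y -> f y = g y) -> U x ->
  {for x, continuous f} -> {for x, continuous g}.
Proof.
move=> oU fg Ux cf; have nfg : \forall y \near x, f y = g y.
  by apply: filterS (open_nbhs_nbhs (conj oU Ux)) => y /fg.
move: cf; rewrite /prop_for /continuous_at (fg x Ux); apply: cvg_trans.
exact: (@near_eq_cvg _ _ (nbhs x) _ f g nfg).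
Qed.

Lemma class_on_ext {R : realType} {d k} (U : set 'rV[R]_d) f g :
  open U -> (forall y, U y -> f y = g y) -> class_on k U f -> class_on k U g.
Proof.
move=> oU; elim: k f g => [|k IHk] f g fg [cf df].
  by split=> [x Ux|//]; exact: continuous_at_ext oU fg Ux (cf x Ux).
split=> [x Ux|i]; first exact: continuous_at_ext oU fg Ux (cf x Ux).
have nfg x : U x -> \forall y \near x, f y = g y.
  by move=> Ux; apply: filterS (open_nbhs_nbhs (conj oU Ux)) => y /fg.
have [dfi dk] := df i; split=> [x Ux|].
  exact: near_eq_derivable (nfg x Ux) (dfi x Ux).
by apply: IHk dk => y Uy; exact: partial_ext oU fg Uy.
Qed.

Lemma class_on_cst {R : realType} {d k} (U : set 'rV[R]_d) (c : R) :
  class_on k U (cst c).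
Proof.
elim: k c => [|k IHk] c; first by split=> [x _|//]; exact: cst_continuous.
split=> [x _|i]; first exact: cst_continuous.
split=> [x _|]; first exact: derivable_cst.
rewrite (_ : partial _ i = cst 0); first exact: IHk.
by apply/funext => x; rewrite /partial derive_cst.
Qed.

Lemma class_onD {R : realType} {d k} (U : set 'rV[R]_d) (f g : 'rV[R]_d -> R) :
  open U -> class_on k U f -> class_on k U g -> class_on k U (f + g).
Proof.
move=> oU; elim: k f g => [|k IHk] f g [cf df] [cg dg].
  by split=> [x Ux|//]; exact: continuousD (cf x Ux) (cg x Ux).
split=> [x Ux|i]; first by exact: continuousD (cf x Ux) (cg x Ux).
have [dfi dfk] := df i; have [dgi dgk] := dg i; split=> [x Ux|].
  by apply: derivableD; [exact: dfi|exact: dgi].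
apply: class_on_ext oU _ (IHk _ _ dfk dgk) => x Ux.
by rewrite /partial deriveD//; [exact: dfi|exact: dgi].
Qed.

Lemma class_onM {R : realType} {d k} (U : set 'rV[R]_d) (f g : 'rV[R]_d -> R) :
  open U -> class_on k U f -> class_on k U g -> class_on k U (f * g).
Proof.
move=> oU; elim: k f g => [|k IHk] f g Hf Hg; have [cf df] := Hf; have [cg dg] := Hg.
  by split=> [x Ux|//]; exact: continuousM (cf x Ux) (cg x Ux).
split=> [x Ux|i]; first by exact: continuousM (cf x Ux) (cg x Ux).
have [dfi dfk] := df i; have [dgi dgk] := dg i; split=> [x Ux|].
  by apply: derivableM; [exact: dfi|exact: dgi].
apply: (@class_on_ext _ _ _ _ (f * partial g i + g * partial f i)) => //.
  by move=> x Ux; rewrite /partial deriveM//; [exact: dfi|exact: dgi].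
by apply: class_onD => //; apply: IHk => //; exact: class_onW.
Qed.

Lemma smooth_onM {R : realType} {d} (U : set 'rV[R]_d) (f g : 'rV[R]_d -> R) :
  open U -> smooth_on U f -> smooth_on U g -> smooth_on U (f * g).
Proof. by move=> oU sf sg k; apply: class_onM. Qed.

Lemma smooth_on_cst {R : realType} {d} (U : set 'rV[R]_d) (c : R) :
  smooth_on U (cst c).
Proof. by move=> k; apply: class_on_cst. Qed.

(** The two difference quotients are equal as functions of the increment. *)
Lemma derive_comp_linear {R : realType} {V W X : normedModType R}
  (L : V -> W) (f : W -> X) (x v : V) : linear L ->
  'D_v (f \o L) x = 'D_(L v) f (L x).
Proof.
move=> linL; rewrite /derive.
rewrite (_ : (fun h => h^-1 *: ((f \o L \o _) _ - _)) =
  (fun h => h^-1 *: ((f \o shift (L x)) (h *: L v) - f (L x))))//.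
by apply/funext => h /=; rewrite linL.
Qed.

Lemma derivable_comp_linear {R : realType} {V W X : normedModType R}
  (L : V -> W) (f : W -> X) (x v : V) : linear L ->
  derivable f (L x) (L v) -> derivable (f \o L) x v.
Proof.
move=> linL; rewrite /derivable.
rewrite (_ : (fun h => h^-1 *: ((f \o L \o _) _ - _)) =
  (fun h => h^-1 *: ((f \o shift (L x)) (h *: L v) - f (L x))))//.
by apply/funext => h /=; rewrite linL.
Qed.

(** Composition with a coordinate projection.  As [L] maps each basis vector to 0
    or to a basis vector, the partial derivatives of [f \o L] are again 0 or of
    the form [partial f j \o L], so the induction on [k] closes. *)
Lemma class_on_comp_coord {R : realType} {N d k} (U : set 'rV[R]_N)
  (V : set 'rV[R]_d) (L : 'rV[R]_N -> 'rV[R]_d) (f : 'rV[R]_d -> R) :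
  linear L -> continuous L ->
  (forall i, L (delta_mx 0 i) = 0 \/ exists j, L (delta_mx 0 i) = delta_mx 0 j) ->
  (forall x, U x -> V (L x)) -> class_on k V f -> class_on k U (f \o L).
Proof.
move=> linL cL Ldelta UV; elim: k f => [|k IHk] f [cf df].
  by split=> [x Ux|//]; apply: continuous_comp; [exact: cL|exact/cf/UV].
split=> [x Ux|i]; first by apply: continuous_comp; [exact: cL|exact/cf/UV].
have [Li|[j Li]] := Ldelta i.
- split=> [x Ux|].
    by apply: derivable_comp_linear => //; rewrite Li; exact: derivable0.
  rewrite (_ : partial _ i = cst 0); first exact: class_on_cst.
  by apply/funext => x; rewrite /partial derive_comp_linear// Li derive0.
have [dfj dfk] := df j; split=> [x Ux|].
  by apply: derivable_comp_linear => //; rewrite Li; exact/dfj/UV.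
rewrite (_ : partial _ i = partial f j \o L); first exact: IHk.
by apply/funext => x; rewrite /partial derive_comp_linear// Li.
Qed.

Lemma lsubmx_delta {R : realType} {n m} (i : 'I_(n + m)) :
  lsubmx (delta_mx 0 i : 'rV[R]_(n + m)) = 0 \/
  exists j, lsubmx (delta_mx 0 i : 'rV[R]_(n + m)) = delta_mx 0 j.
Proof.
case: (split_ordP i) => j ->; [right; exists j|left]; apply/rowP => l.
  by rewrite !mxE !eqxx /= eq_lshift.
by rewrite !mxE eq_lrshift andbF.
Qed.

Lemma rsubmx_delta {R : realType} {n m} (i : 'I_(n + m)) :
  rsubmx (delta_mx 0 i : 'rV[R]_(n + m)) = 0 \/
  exists j, rsubmx (delta_mx 0 i : 'rV[R]_(n + m)) = delta_mx 0 j.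
Proof.
case: (split_ordP i) => j ->; [left|right; exists j]; apply/rowP => l.
  by rewrite !mxE eq_rlshift andbF.
by rewrite !mxE !eqxx /= eq_rshift.
Qed.

Lemma smooth_on_lsubmx {R : realType} {n m} (U : set 'rV[R]_(n + m))
  (V : set 'rV[R]_n) (f : 'rV[R]_n -> R) :
  (forall x, U x -> V (lsubmx x)) -> smooth_on V f ->
  smooth_on U (fun x => f (lsubmx x)).
Proof.
move=> UV sf k; apply: (class_on_comp_coord _ _ _ _ _ _ _ UV (sf k)).
- by move=> a u v; rewrite linearP.
- exact: continuous_lsubmx.
- exact: lsubmx_delta.
Qed.

Lemma smooth_on_rsubmx {R : realType} {n m} (U : set 'rV[R]_(n + m))
  (V : set 'rV[R]_m) (f : 'rV[R]_m -> R) :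
  (forall x, U x -> V (rsubmx x)) -> smooth_on V f ->
  smooth_on U (fun x => f (rsubmx x)).
Proof.
move=> UV sf k; apply: (class_on_comp_coord _ _ _ _ _ _ _ UV (sf k)).
- by move=> a u v; rewrite linearP.
- exact: continuous_rsubmx.
- exact: rsubmx_delta.
Qed.

Lemma linear_form_linear {R : realType} {n} (alpha : 'I_n -> R) a (x y : 'rV[R]_n) :
  linear_form alpha (a *: x + y) = a * linear_form alpha x + linear_form alpha y.
Proof.
rewrite /linear_form mulr_sumr -big_split/=; apply: eq_bigr => i _.
by rewrite !mxE; ring.
Qed.

Lemma linear_form_delta {R : realType} {n} (alpha : 'I_n -> R) i :
  linear_form alpha (delta_mx 0 i) = alpha i.
Proof.
rewrite /linear_form (bigD1 i)//= big1 ?addr0 => [|j ji]; rewrite mxE eqxx/=.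
  by rewrite eqxx mulr1.
by rewrite (negbTE ji) mulr0.
Qed.

Lemma linear_form_continuous {R : realType} {n} (alpha : 'I_n -> R) :
  continuous (linear_form alpha : 'rV[R]_n -> R).
Proof.
apply: continuous_big => [|i _ x]; first exact: (@add_continuous R).
exact: (continuousM (@cst_continuous _ _ (alpha i) x) (@coord_continuous R 1 n 0 i x)).
Qed.

Lemma derivable_dir {R : realType} (g : R -> R) (t c : R) :
  derivable g t 1 -> derivable g t c.
Proof. by move=> /derivable1_diffP dg; exact: diff_derivable. Qed.

Lemma derive_dir {R : realType} (g : R -> R) (t c : R) :
  derivable g t 1 -> 'D_c g t = c * g^`()%classic t.
Proof.
move=> dg; have /derivable1_diffP dfg := dg.
by rewrite deriveE// deriv1E.
Qed.

Lemma partial_linear_form {R : realType} {n} (alpha : 'I_n -> R) (g : R -> R) i x :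
  derivable g (linear_form alpha x) 1 ->
  partial (fun y => g (linear_form alpha y)) i x =
  alpha i * g^`()%classic (linear_form alpha x).
Proof.
move=> dg; rewrite /partial (@derive_comp_linear _ _ R _ (linear_form alpha) g).
  by rewrite linear_form_delta derive_dir.
by move=> a u v; rewrite linear_form_linear.
Qed.

Lemma smooth_on_linear_form {R : realType} {n} (alpha : 'I_n -> R) (g : R -> R) U :
  smooth_real g -> smooth_on U (fun x => g (linear_form alpha x)).
Proof.
move=> sg k; elim: k g sg => [|k IHk] g sg.
  split=> [x _|//]; apply: (@continuous_comp _ _ _ (linear_form alpha) g).
    exact: linear_form_continuous.
  exact: is_derive_continuous (smooth_real_is_derive _ _ sg).
split=> [x _|i].
  apply: (@continuous_comp _ _ _ (linear_form alpha) g).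
    exact: linear_form_continuous.
  exact: is_derive_continuous (smooth_real_is_derive _ _ sg).
split=> [x _|].
  apply: (@derivable_comp_linear _ _ R _ (linear_form alpha) g).
    by move=> a u v; rewrite linear_form_linear.
  by apply: derivable_dir; exact: (sg 0%N).
have -> : partial (fun y => g (linear_form alpha y)) i =
    fun x => (cst (alpha i) * g^`()%classic) (linear_form alpha x).
  by apply/funext => x; rewrite partial_linear_form//; exact: (sg 0%N).
apply/IHk/smooth_realM; last exact: smooth_real_derive1.
by rewrite smooth_realP => j; exact: derivable_upto_cst.
Qed.

(** * Products, rescalings and warped products *)

Lemma hausdorff_prod {S T : topologicalType} :
  hausdorff_space S -> hausdorff_space T -> hausdorff_space (S * T)%type.
Proof.
move=> hS hT [p1 p2] [q1 q2] pq; congr pair.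
  apply: hS => A B pA qB.
  have [||[x y] [[/= Ax _] [/= Bx _]]] := pq (A `*` setT) (B `*` setT).
  - by exists (A, setT) => //; split=> //; exact: filterT.
  - by exists (B, setT) => //; split=> //; exact: filterT.
  by exists x.
apply: hT => A B pA qB.
have [||[x y] [[/= _ Ay] [/= _ By]]] := pq (setT `*` A) (setT `*` B).
- by exists (setT, A) => //; split=> //; exact: filterT.
- by exists (setT, B) => //; split=> //; exact: filterT.
by exists y.
Qed.

Lemma open_setX {S T : topologicalType} (A : set S) (B : set T) :
  open A -> open B -> open (A `*` B).
Proof.
move=> oA oB; rewrite openE => -[x y] [/= Ax By].
by exists (A, B) => //; split; exact: open_nbhs_nbhs.
Qed.

Lemma second_countable_prod {S T : topologicalType} :
  @second_countable S -> @second_countable T ->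
  @second_countable (S * T)%type.
Proof.
move=> [B1 cB1 [oB1 bB1]] [B2 cB2 [oB2 bB2]].
exists (\bigcup_(U in B1) ((fun V => U `*` V) @` B2)).
  apply: bigcup_countable => // U _; exact: sub_countable (card_image_le _ _) cB2.
split=> [_ [U B1U [V B2V <-]]|[x y] A [[P Q] [/= xP yQ] PQA]].
  by apply: open_setX; [exact: oB1|exact: oB2].
have [U [B1U Ux] UP] := bB1 x P xP.
have [V [B2V Vy] VQ] := bB2 y Q yQ.
exists (U `*` V); first by split; [exists U => //; exists V|split].
by apply: subset_trans PQA => -[a b] [/= /UP Pa /VQ Qb].
Qed.

(** The balls with rational centre and radius form a basis. *)
Lemma second_countable_rV {R : realType} {n} : @second_countable 'rV[R]_n.
Proof.
pose box (cr : 'rV[rat]_n * rat) : set 'rV[R]_n := ball (\row_j (ratr (cr.1 0 j) : R)) (ratr cr.2 : R).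
exists (box @` setT); first exact: sub_countable (card_image_le _ _) (countableP _).
split=> [_ [cr _ <-]|x A].
  have [e0|e0] := ltP 0 (ratr cr.2 : R); first exact: ball_open.
  rewrite (_ : box cr = set0); first exact: open0.
  by rewrite -subset0 => y [/lt_le_trans/(_ e0)]; rewrite ltxx.
move=> /nbhs_ballP[e /= e0 eA].
have /rat_in_itvoo[r] : 0 < e / 2 by rewrite divr_gt0.
rewrite in_itv/= => /andP[r0 re].
have cP (j : 'I_n) : exists c : rat, ball (x 0 j) (ratr r) (ratr c : R).
  have /rat_in_itvoo[c] : x 0 j - ratr r < x 0 j + ratr r by lra.
  rewrite in_itv/= => /andP[c1 c2]; exists c.
  by rewrite -ball_normE/= ltr_norml; lra.
have /choice[c {}cP] := cP.
have xc : ball x (ratr r) (\row_j (ratr ((\row_k c k : 'rV[rat]_n) 0 j) : R)).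
  by split=> // i j; rewrite !mxE ord1; exact: cP.
exists (box (\row_j c j, r)); first by split; [exists (\row_j c j, r)|exact: ball_sym].
apply: subset_trans eA => y yc; apply: (@le_ball _ _ _ (ratr r + ratr r)); first by lra.
exact: ball_triangle xc yc.
Qed.

Lemma smooth_on_coord {R : realType} {n} (U : set 'rV[R]_n) (j : 'I_n) :
  smooth_on U (fun x : 'rV[R]_n => x 0 j).
Proof.
pose alpha i : R := (i == j)%:R.
rewrite (_ : (fun x => _) = fun x => id (linear_form alpha x)).
  apply: (@smooth_on_linear_form _ _ alpha id); rewrite smooth_realP => -[|k].
    by apply: (@derivable_upto0 _ _ (cst 1)) => t; exact: is_derive_id.
  apply: (@derivable_uptoS _ _ _ (cst 1)); exact: derivable_upto_cst.
apply/funext => x /=; rewrite /linear_form (bigD1 j)//= big1 ?addr0.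
  by rewrite /alpha eqxx mul1r.
by move=> i ij; rewrite /alpha (negbTE ij) mul0r.
Qed.

Lemma euclidean_smooth_manifold {R : realType} {n} :
  smooth_manifold (euclidean_space R n).
Proof.
split.
- exact: (@norm_hausdorff R 'rV[R]_n).
- exact: second_countable_rV.
- by move=> a; exact: openT.
- by move=> p; exists tt.
- by move=> a; rewrite /chart_image/= image_id; exact: openT.
- by [].
- by move=> a p _; exact: cvg_id.
- by move=> a x _; exact: cvg_id.
- by move=> a b j; exact: smooth_on_coord.
Qed.

(** The field [chart_image_open] with its chart as an explicit argument. *)
Lemma open_chart_image {R : realType} {d} {M : charted_space R d} :
  smooth_manifold M -> forall a : chart M, open (chart_image a).
Proof. by case. Qed.

Section product.
Context {R : realType} {n m : nat}.
Variables (B : charted_space R n) (F : charted_space R m).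

Lemma product_chart_image (ab : chart (product_space B F)) x :
  chart_image ab x <->
  chart_image (ab.1 : chart B) (lsubmx x) /\ chart_image (ab.2 : chart F) (rsubmx x).
Proof.
split=> [[p [pB pF] <-]|[[p pB pE] [q qF qE]]].
  by rewrite /= row_mxKl row_mxKr; split; [exists p.1|exists p.2].
by exists (p, q) => //=; rewrite pE qE hsubmxK.
Qed.

Lemma product_overlap (ab cd : chart (product_space B F)) x :
  overlap ab cd x -> overlap (ab.1 : chart B) cd.1 (lsubmx x) /\
                     overlap (ab.2 : chart F) cd.2 (rsubmx x).
Proof.
move=> [p [[pB pF] [p'B p'F]] <-] /=.
by rewrite row_mxKl row_mxKr; split; [exists p.1|exists p.2].
Qed.

Lemma open_lsubmx_rsubmx (U : set 'rV[R]_n) (V : set 'rV[R]_m) :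
  open U -> open V ->
  open [set x : 'rV[R]_(n + m) | U (lsubmx x) /\ V (rsubmx x)].
Proof.
move=> oU oV; apply: openI.
  by apply: open_comp oU => x _; exact: continuous_lsubmx.
by apply: open_comp oV => x _; exact: continuous_rsubmx.
Qed.

Lemma row_mx_continuous {T : topologicalType} (u : T -> 'rV[R]_n) (v : T -> 'rV[R]_m) t :
  {for t, continuous u} -> {for t, continuous v} ->
  {for t, continuous (fun s => row_mx (u s) (v s))}.
Proof.
move=> cu cv A /nbhs_ballP[e /= e0 eA].
have nu := cu _ (nbhsx_ballx (u t) e e0); have nv := cv _ (nbhsx_ballx (v t) e e0).
change (nbhs t (fun s => A (row_mx (u s) (v s)))).
near=> s.
have [_ us] : ball (u t) e (u s) by near: s; exact: nu.
have [_ vs] : ball (v t) e (v s) by near: s; exact: nv.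
apply: eA; split=> // i j.
by case: (split_ordP j) => k ->; rewrite ?row_mxEl ?row_mxEr.
Unshelve. all: by end_near. Qed.

Lemma product_smooth_manifold :
  smooth_manifold B -> smooth_manifold F -> smooth_manifold (product_space B F).
Proof.
move=> mB mF; split.
- exact: hausdorff_prod (manifold_hausdorff mB) (manifold_hausdorff mF).
- exact: second_countable_prod (manifold_countable mB) (manifold_countable mF).
- by move=> [a b]; exact: open_setX (chart_dom_open mB a) (chart_dom_open mF b).
- move=> [p q]; have [a pa] := chart_dom_cover mB p; have [b qb] := chart_dom_cover mF q.
  by exists (a, b).
- move=> [a b]; rewrite (_ : chart_image _ = [set x | chart_image a (lsubmx x) /\
                                                      chart_image b (rsubmx x)]).
    exact: open_lsubmx_rsubmx _ _ (open_chart_image mB a) (open_chart_image mF b).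
  by apply/seteqP; split=> x; [exact: (product_chart_image (a, b) x).1|exact: (product_chart_image (a, b) x).2].
- move=> [a b] [p q] [/= pa qb].
  by rewrite row_mxKl row_mxKr (chart_mapK mB pa) (chart_mapK mF qb).
- move=> [a b] [p q] [/= pa qb]; apply: row_mx_continuous.
    apply: (@continuous_comp _ _ _ fst (chart_map a)); first exact: cvg_fst.
    exact: (chart_map_continuous mB pa).
  apply: (@continuous_comp _ _ _ snd (chart_map b)); first exact: cvg_snd.
  exact: (chart_map_continuous mF qb).
- move=> [a b] x /product_chart_image[/= xa xb].
  have ca : {for x, continuous (fun y : 'rV[R]_(n + m) => chart_inv a (lsubmx y))}.
    apply: (@continuous_comp _ _ _ (lsubmx : 'rV[R]_(n + m) -> 'rV[R]_n) (chart_inv a) x).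
      exact: continuous_lsubmx.
    exact: (chart_inv_continuous mB xa).
  have cb : {for x, continuous (fun y : 'rV[R]_(n + m) => chart_inv b (rsubmx y))}.
    apply: (@continuous_comp _ _ _ (rsubmx : 'rV[R]_(n + m) -> 'rV[R]_m) (chart_inv b) x).
      exact: continuous_rsubmx.
    exact: (chart_inv_continuous mF xb).
  exact: (cvg_pair ca cb).
- move=> [a b] [c d] j; case: (split_ordP j) => k ->.
    rewrite (_ : (fun x => _) = (fun x => transition a c (lsubmx x) 0 k)).
      apply: smooth_on_lsubmx (transition_smooth mB a c k).
      by move=> x /product_overlap[].
    by apply/funext => x; rewrite /transition/= row_mxEl.
  rewrite (_ : (fun x => _) = (fun x => transition b d (rsubmx x) 0 k)).
    apply: smooth_on_rsubmx (transition_smooth mF b d k).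
    by move=> x /product_overlap[].
  by apply/funext => x; rewrite /transition/= row_mxEr.
Qed.

End product.

Lemma partial_lsubmx_l {R : realType} {n m} (f : 'rV[R]_n -> R) i (x : 'rV[R]_(n + m)) :
  partial (fun y : 'rV[R]_(n + m) => f (lsubmx y)) (lshift m i) x = partial f i (lsubmx x).
Proof.
rewrite /partial (@derive_comp_linear _ _ _ _ lsubmx f); last by move=> a u v; rewrite linearP.
rewrite (_ : lsubmx (delta_mx _ _) = delta_mx 0 i)//.
by apply/rowP => l; rewrite !mxE !eqxx /= eq_lshift.
Qed.

Lemma partial_lsubmx_r {R : realType} {n m} (f : 'rV[R]_n -> R) i (x : 'rV[R]_(n + m)) :
  partial (fun y : 'rV[R]_(n + m) => f (lsubmx y)) (rshift n i) x = 0.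
Proof.
rewrite /partial (@derive_comp_linear _ _ _ _ lsubmx f); last by move=> a u v; rewrite linearP.
rewrite (_ : lsubmx (delta_mx _ _) = 0) ?derive0//.
by apply/rowP => l; rewrite !mxE eq_lrshift andbF.
Qed.

Lemma partial_rsubmx_r {R : realType} {n m} (f : 'rV[R]_m -> R) i (x : 'rV[R]_(n + m)) :
  partial (fun y : 'rV[R]_(n + m) => f (rsubmx y)) (rshift n i) x = partial f i (rsubmx x).
Proof.
rewrite /partial (@derive_comp_linear _ _ _ _ rsubmx f); last by move=> a u v; rewrite linearP.
rewrite (_ : rsubmx (delta_mx _ _) = delta_mx 0 i)//.
by apply/rowP => l; rewrite !mxE !eqxx /= eq_rshift.
Qed.

Lemma partial_rsubmx_l {R : realType} {n m} (f : 'rV[R]_m -> R) i (x : 'rV[R]_(n + m)) :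
  partial (fun y : 'rV[R]_(n + m) => f (rsubmx y)) (lshift m i) x = 0.
Proof.
rewrite /partial (@derive_comp_linear _ _ _ _ rsubmx f); last by move=> a u v; rewrite linearP.
rewrite (_ : rsubmx (delta_mx _ _) = 0) ?derive0//.
by apply/rowP => l; rewrite !mxE eq_rlshift andbF.
Qed.

(** The transition maps of a product split, and so do their Jacobians; this is
    why block diagonal components transform as a tensor. *)
Lemma jacobian_mx_block {R : realType} {n m p q : nat} (h1 : 'rV[R]_n -> 'rV[R]_p)
    (h2 : 'rV[R]_m -> 'rV[R]_q) x :
  jacobian_mx (fun y : 'rV[R]_(n + m) => row_mx (h1 (lsubmx y)) (h2 (rsubmx y))) x =
  block_mx (jacobian_mx h1 (lsubmx x)) 0 0 (jacobian_mx h2 (rsubmx x)).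
Proof.
have El (j : 'I_p) : (fun y : 'rV[R]_(n + m) =>
    row_mx (h1 (lsubmx y)) (h2 (rsubmx y)) 0 (lshift q j)) = fun y => h1 (lsubmx y) 0 j.
  by apply/funext => y; rewrite row_mxEl.
have Er (j : 'I_q) : (fun y : 'rV[R]_(n + m) =>
    row_mx (h1 (lsubmx y)) (h2 (rsubmx y)) 0 (rshift p j)) = fun y => h2 (rsubmx y) 0 j.
  by apply/funext => y; rewrite row_mxEr.
apply/matrixP => i j; rewrite mxE.
case: (split_ordP i) => i' ->; case: (split_ordP j) => j' ->.
- by rewrite El block_mxEul mxE (partial_lsubmx_l (fun y => h1 y 0 j')).
- by rewrite Er block_mxEur mxE (partial_rsubmx_l (fun y => h2 y 0 j')).
- by rewrite El block_mxEdl mxE (partial_lsubmx_r (fun y => h1 y 0 j')).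
- by rewrite Er block_mxEdr mxE (partial_rsubmx_r (fun y => h2 y 0 j')).
Qed.

Lemma block_diag_unitmx {R : realType} {n m} (A : 'M[R]_n) (B : 'M[R]_m) :
  A \in unitmx -> B \in unitmx -> block_mx A 0 0 B \in unitmx.
Proof. by rewrite !unitmxE det_ublock unitrM => -> ->. Qed.

Theorem scale_semi_riemannian {R : realType} {d} (M : charted_space R d)
    (h : carrier M -> R) (g : tensor02 M) :
  semi_riemannian g -> (forall p, 0 < h p) ->
  (forall a : chart M, smooth_on (chart_image a) (fun x => h (chart_inv a x))) ->
  semi_riemannian (scale_metric h g).
Proof.
move=> [mM tg sg symg ndg [nu indg]] h0 sh; split.
- exact: mM.
- move=> a b x abx; rewrite /scale_metric.
  have -> : chart_inv b (transition a b x) = chart_inv a x.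
    case: abx => p [pa pb] <-.
    by rewrite /transition (chart_mapK mM pa) (chart_mapK mM pb).
  by rewrite (tg a b x abx) -scalemxAr -scalemxAl.
- move=> a i j; rewrite (_ : (fun x => _) =
      (fun x => h (chart_inv a x)) * (fun x => g a x i j)).
    exact: smooth_onM (open_chart_image mM a) (sh a) (sg a i j).
  by apply/funext => x; rewrite /scale_metric mxE.
- by move=> a x ax; rewrite /scale_metric linearZ/= symg.
- by move=> a x ax; rewrite /scale_metric unitmxZ ?ndg// unitfE gt_eqF.
- exists nu => a x ax; apply: has_index_scale => //; exact: indg.
Qed.

Theorem warped_semi_riemannian {R : realType} {n m} (B : charted_space R n)
    (gB : tensor02 B) (f : carrier B -> R) (F : charted_space R m) (gF : tensor02 F) :
  semi_riemannian gB -> semi_riemannian gF -> (forall p, 0 < f p) ->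
  (forall a : chart B, smooth_on (chart_image a) (fun x => f (chart_inv a x))) ->
  semi_riemannian (warped_metric gB f gF).
Proof.
move=> [mB tB sB symB ndB [nu indB]] [mF tF sF symF ndF [mu indF]] f0 sf.
have mP := product_smooth_manifold _ _ mB mF.
have f20 p : 0 < f p ^+ 2 by rewrite exprn_gt0.
split.
- exact: mP.
- move=> [a b] [c d] x abx; have [/= ax bx] := product_overlap _ _ _ _ _ abx.
  have trE : (transition ((a, b) : chart (product_space B F)) (c, d)) =
      fun y => row_mx (transition a c (lsubmx y)) (transition b d (rsubmx y)) by [].
  rewrite /warped_metric trE jacobian_mx_block row_mxKl row_mxKr /=.
  have -> : chart_inv c (transition a c (lsubmx x)) = chart_inv a (lsubmx x).
    case: ax => p [pa pc] <-.
    by rewrite /transition (chart_mapK mB pa) (chart_mapK mB pc).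
  rewrite (tB a c _ ax) (tF b d _ bx) tr_block_mx !mulmx_block !trmx0.
  by rewrite !(mulmx0, mul0mx, addr0, add0r) -scalemxAr -scalemxAl.
- move=> [a b] i j; have oab := open_chart_image mP (a, b).
  have imab x : chart_image ((a, b) : chart (product_space B F)) x ->
      chart_image a (lsubmx x) /\ chart_image b (rsubmx x).
    by move=> /product_chart_image.
  case: (split_ordP i) => i' ->; case: (split_ordP j) => j' ->.
  + rewrite (_ : (fun x => _) = (fun x => gB a (lsubmx x) i' j')).
      by apply: smooth_on_lsubmx (sB a i' j') => x /imab[].
    by apply/funext => x; rewrite /warped_metric block_mxEul.
  + rewrite (_ : (fun x => _) = cst 0); first exact: smooth_on_cst.
    by apply/funext => x; rewrite /warped_metric block_mxEur mxE.
  + rewrite (_ : (fun x => _) = cst 0); first exact: smooth_on_cst.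
    by apply/funext => x; rewrite /warped_metric block_mxEdl mxE.
  + pose fl (x : 'rV[R]_(n + m)) := f (chart_inv a (lsubmx x)).
    rewrite (_ : (fun x => _) = fl * fl * (fun x => gF b (rsubmx x) i' j')).
      have sfl : smooth_on (chart_image ((a, b) : chart (product_space B F))) fl.
        by apply: smooth_on_lsubmx (sf a) => x /imab[].
      apply: smooth_onM (oab) (smooth_onM _ _ _ oab sfl sfl) _.
      by apply: smooth_on_rsubmx (sF b i' j') => x /imab[].
    by apply/funext => x; rewrite /warped_metric block_mxEdr mxE expr2.
- move=> [a b] x /product_chart_image[/= ax bx].
  by rewrite /warped_metric tr_block_mx linearZ/= symB// symF// !trmx0.
- move=> [a b] x /product_chart_image[/= ax bx].
  apply: block_diag_unitmx; first exact: ndB.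
  by rewrite unitmxZ ?ndF// unitfE gt_eqF.
- exists (nu + mu)%N => -[a b] x /product_chart_image[/= ax bx].
  apply: has_index_block; first exact: symB.
  + by rewrite linearZ/= symF.
  + exact: indB.
  + by apply: has_index_scale => //; exact: indF.
Qed.

Theorem pseudo_euclidean_semi_riemannian {R : realType} {n} (eps : 'I_n -> R) :
  (forall i, eps i != 0) -> semi_riemannian (pseudo_euclidean eps).
Proof.
move=> eps0.
have E : (\matrix_(i, j) ((i == j)%:R * eps i)) = diag_mx (\row_i eps i) :> 'M[R]_n.
  apply/matrixP => i j; rewrite !mxE; case: eqVneq => [->|_].
    by rewrite mul1r mulr1n.
  by rewrite mul0r mulr0n.
split.
- exact: euclidean_smooth_manifold.
- move=> a b x _; rewrite (_ : jacobian_mx _ _ = 1%:M) ?mul1mx ?trmx1 ?mulmx1//.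
  apply/matrixP => i j; rewrite !mxE /partial.
  pose alpha k : R := (k == j)%:R.
  have cE : (fun y : 'rV[R]_n => y 0 j) = linear_form alpha.
    apply/funext => y /=; rewrite /linear_form (bigD1 j)//= big1 /alpha ?addr0 ?eqxx ?mul1r//.
    by move=> k /negbTE ->; rewrite mul0r.
  have did : derivable (id : R -> R) (linear_form alpha x) 1 by exact: derivable_id.
  have := @partial_linear_form R n alpha id i x did.
  rewrite derive1_id mulr1 -[fun y => id _]/(linear_form alpha) -cE.
  exact.
- by move=> a i j; exact: smooth_on_cst.
- by move=> a x _; rewrite /pseudo_euclidean E tr_diag_mx.
- move=> a x _; rewrite /pseudo_euclidean E unitmxE det_diag unitfE.
  by apply/prodf_neq0 => i _; rewrite mxE.
- have [nu nuP] := has_index_exists (\matrix_(i, j) ((i == j)%:R * eps i)).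
  by exists nu.
Qed.

(** * Algebra of the curvature sums *)

Lemma sum_deltar {R : realType} {n} (F : 'I_n -> R) (j : 'I_n) :
  \sum_i F i * (i == j)%:R = F j.
Proof.
rewrite (bigD1 j)//= eqxx mulr1 big1 ?addr0// => i /negbTE ->.
by rewrite mulr0.
Qed.

Lemma partial_cst {R : realType} {d} (c : R) (i : 'I_d) (x : 'rV[R]_d) :
  partial (fun=> c) i x = 0.
Proof. exact: derive_cst. Qed.

(** The traces of the Christoffel symbols are isolated because they have a simple
    closed form for the warped metric. *)
Lemma ricciE {R : realType} {d} (G : 'rV[R]_d -> 'M[R]_d) (j k : 'I_d) x :
  ricci G j k x =
  \sum_i partial (christoffel G i j k) i x
  - \sum_i partial (christoffel G i i k) j x
  + \sum_p christoffel G p j k x * (\sum_i christoffel G i i p x)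
  - \sum_i \sum_p christoffel G p i k x * christoffel G i j p x.
Proof.
rewrite /ricci /riemann; under eq_bigr do rewrite big_split/= sumrN.
rewrite !big_split/= !sumrN addrA; congr (_ + _ - _).
by rewrite exchange_big/=; apply: eq_bigr => p _; rewrite mulr_sumr.
Qed.

Lemma christoffel_sym {R : realType} {d} (V : set 'rV[R]_d) (H : 'rV[R]_d -> 'M[R]_d) k i j x :
  open V -> (forall y, V y -> (H y)^T = H y) -> V x ->
  christoffel H k i j x = christoffel H k j i x.
Proof.
move=> oV symH Vx; rewrite /christoffel; congr (_ * _); apply: eq_bigr => l _.
congr (_ * _); rewrite [X in X - _]addrC; congr (_ - _).
by apply: (partial_ext V) => // y Vy; rewrite -{1}(symH y Vy) mxE.
Qed.

Section conformal_coefficients.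
Context {R : realType} {n : nat}.
Variables (eps alpha : 'I_n -> R).
Hypothesis eps2 : forall i, eps i * eps i = 1.
Hypothesis null : \sum_(i < n) eps i * alpha i ^+ 2 = 0.

(** Up to the factor p = u' / (2 u), the Christoffel symbols of the conformally
    flat metric u(xi) diag(eps). *)
Definition conformal_coef (k i j : 'I_n) : R :=
  alpha i * (k == j)%:R + alpha j * (k == i)%:R
  - eps i * (i == j)%:R * (eps k * alpha k).

Lemma null_contraction : \sum_i alpha i * (eps i * alpha i) = 0.
Proof. by rewrite -[RHS]null; apply: eq_bigr => i _; ring. Qed.

Lemma conformal_coef_div j k : \sum_i alpha i * conformal_coef i j k = 2 * alpha j * alpha k.
Proof.
rewrite (eq_bigr (fun i => alpha i * alpha j * (i == k)%:R +
    alpha i * alpha k * (i == j)%:R +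
    (- (eps j * (j == k)%:R)) * (alpha i * (eps i * alpha i)))) => [|i _]; last first.
  by rewrite /conformal_coef; ring.
by rewrite !big_split/= !sum_deltar -mulr_sumr null_contraction; ring.
Qed.

Lemma conformal_coef_trace k : \sum_i conformal_coef i i k = n%:R * alpha k.
Proof.
rewrite (eq_bigr (fun i => alpha i * (i == k)%:R + alpha k
    - eps i * (eps i * alpha i) * (i == k)%:R)) => [|i _]; last first.
  by rewrite /conformal_coef eqxx mulr1n; ring.
rewrite !big_split/= sumrN !sum_deltar sumr_const card_ord mulrA eps2 mul1r.
by rewrite -mulr_natl; ring.
Qed.

(** The vector dual to [alpha] is null, so one of the three terms vanishes; the
    other two cancel. *)
Lemma conformal_coef_beta i j : \sum_p eps p * alpha p * conformal_coef i j p = 0.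
Proof.
rewrite (eq_bigr (fun p => eps p * alpha p * alpha j * (p == i)%:R +
    (i == j)%:R * (alpha p * (eps p * alpha p)) +
    - (eps j * (eps i * alpha i)) * (eps p * alpha p) * (p == j)%:R)) => [|p _]; last first.
  by rewrite /conformal_coef [i == p]eq_sym [j == p]eq_sym; ring.
rewrite !big_split/= !sum_deltar -mulr_sumr null_contraction.
by ring: (eps2 j).
Qed.

Lemma conformal_coef_quad j k :
  \sum_i \sum_p conformal_coef p i k * conformal_coef i j p = (n%:R + 2) * alpha j * alpha k.
Proof.
have inner i : \sum_p conformal_coef p i k * conformal_coef i j p =
    alpha i * conformal_coef i j k + alpha k * conformal_coef i j i.
  rewrite (eq_bigr (fun p => alpha i * conformal_coef i j p * (p == k)%:R +
      alpha k * conformal_coef i j p * (p == i)%:R +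
      - (eps i * (i == k)%:R) * (eps p * alpha p * conformal_coef i j p))) => [|p _]; last first.
    by rewrite /conformal_coef; ring.
  by rewrite !big_split/= !sum_deltar -mulr_sumr conformal_coef_beta; ring.
under eq_bigr do rewrite inner.
rewrite big_split/= conformal_coef_div -mulr_sumr.
rewrite (eq_bigr (fun i => conformal_coef i i j)) => [|i _]; last first.
  by have [->//|ij] := eqVneq i j; rewrite /conformal_coef [j == i]eq_sym (negbTE ij) /=; ring.
by rewrite conformal_coef_trace; ring.
Qed.

End conformal_coefficients.

(** * Curvature of the warped product *)

(** The metric in a product chart.  [u] and [w] are functions of the null
    coordinate [xi], and [H] is the matrix of the fiber metric in a chart with
    image [V].  In the names below the letters [l] and [r] stand for the base
    (left) and fiber (right) indices, in the order of the index positions. *)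
Section warped_wave_metric.
Context {R : realType} {n m : nat}.
Variables (eps alpha : 'I_n -> R).
Hypothesis eps2 : forall i, eps i * eps i = 1.
Hypothesis null : \sum_(i < n) eps i * alpha i ^+ 2 = 0.
Variables (u w : R -> R).
Hypotheses (su : smooth_real u) (sw : smooth_real w).
Hypotheses (u0 : forall t, 0 < u t) (w0 : forall t, 0 < w t).
Variables (V : set 'rV[R]_m) (H : 'rV[R]_m -> 'M[R]_m).
Hypothesis oV : open V.
Hypothesis dH : forall a b c x, V x -> derivable (fun y => H y a b) x (delta_mx 0 c).
Hypothesis symH : forall y, V y -> (H y)^T = H y.
Hypothesis unitH : forall y, V y -> H y \in unitmx.

Let xi (y : 'rV[R]_(n + m)) := linear_form alpha (lsubmx y).
Let E : 'M[R]_n := \matrix_(i, j) ((i == j)%:R * eps i).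
Let G (y : 'rV[R]_(n + m)) : 'M[R]_(n + m) :=
  block_mx (u (xi y) *: E) 0 0 (w (xi y) *: H (rsubmx y)).
Let U := [set y : 'rV[R]_(n + m) | V (rsubmx y)].

Let oU : open U.
Proof. by apply: open_comp oV => x _; exact: continuous_rsubmx. Qed.

Let xi_linear : linear (xi : _ -> R^o).
Proof. by move=> a x y; rewrite /xi linearP linear_form_linear. Qed.

Let xi_l i : xi (delta_mx 0 (lshift m i)) = alpha i.
Proof.
rewrite /xi (_ : lsubmx _ = delta_mx 0 i) ?linear_form_delta//.
by apply/rowP => l; rewrite !mxE !eqxx /= eq_lshift.
Qed.

Let xi_r c : xi (delta_mx 0 (rshift n c)) = 0.
Proof.
rewrite /xi (_ : lsubmx _ = 0); last by apply/rowP => l; rewrite !mxE eq_lrshift andbF.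
by rewrite /linear_form big1// => i _; rewrite mxE mulr0.
Qed.

(** In a base direction the factor [h] is constant along the line through [x],
    so only the derivative of [g] contributes. *)
Lemma partial_sep_l (g : R -> R) (h : 'rV[R]_m -> R) i x : smooth_real g ->
  partial (fun y => g (xi y) * h (rsubmx y)) (lshift m i) x =
  alpha i * g^`()%classic (xi x) * h (rsubmx x).
Proof.
move=> sg; have dg t := sg 0%N t.
have dgx v : derivable (g \o xi) x v.
  by apply: (@derivable_comp_linear _ _ R^o _ _ _ _ _ xi_linear); exact: derivable_dir (dg _).
have r0 : rsubmx (delta_mx 0 (lshift m i) : 'rV[R]_(n + m)) = 0.
  by apply/rowP => l; rewrite !mxE eq_rlshift andbF.
have linr : linear (rsubmx : 'rV[R]_(n + m) -> 'rV[R]_m) by move=> a y z; rewrite linearP.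
have dhx : derivable (h \o rsubmx) x (delta_mx 0 (lshift m i)).
  by apply: (derivable_comp_linear _ _ _ _ linr); rewrite r0; exact: derivable0.
rewrite /partial (deriveM (dgx _) dhx) (derive_comp_linear _ _ _ _ linr) r0 derive0.
rewrite scaler0 add0r (@derive_comp_linear _ _ R^o _ _ _ _ _ xi_linear) xi_l.
rewrite derive_dir; last exact: dg.
by rewrite /GRing.scale/= mulrC.
Qed.

Lemma partial_sep_r (g : R -> R) (h : 'rV[R]_m -> R) c x : smooth_real g ->
  derivable h (rsubmx x) (delta_mx 0 c) ->
  partial (fun y => g (xi y) * h (rsubmx y)) (rshift n c) x =
  g (xi x) * partial h c (rsubmx x).
Proof.
move=> sg dh; have dg t := sg 0%N t.
have dgx v : derivable (g \o xi) x v.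
  by apply: (@derivable_comp_linear _ _ R^o _ _ _ _ _ xi_linear); exact: derivable_dir (dg _).
have rc : rsubmx (delta_mx 0 (rshift n c) : 'rV[R]_(n + m)) = delta_mx 0 c.
  by apply/rowP => l; rewrite !mxE !eqxx /= eq_rshift.
have linr : linear (rsubmx : 'rV[R]_(n + m) -> 'rV[R]_m) by move=> a y z; rewrite linearP.
have dhx : derivable (h \o rsubmx) x (delta_mx 0 (rshift n c)).
  by apply: (derivable_comp_linear _ _ _ _ linr); rewrite rc; exact: dh.
rewrite /partial (deriveM (dgx _) dhx) (derive_comp_linear _ _ _ _ linr) rc.
rewrite (@derive_comp_linear _ _ R^o _ _ _ _ _ xi_linear) xi_r.
by rewrite derive0 scaler0 addr0.
Qed.

Lemma partial_xi_l (g : R -> R) (c : R) i x : smooth_real g ->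
  partial (fun y => g (xi y) * c) (lshift m i) x = alpha i * g^`()%classic (xi x) * c.
Proof. by move=> sg; exact: (partial_sep_l _ (cst c) i x sg). Qed.

Lemma partial_xi_r (g : R -> R) (c : R) a x : smooth_real g ->
  partial (fun y => g (xi y) * c) (rshift n a) x = 0.
Proof.
move=> sg; have := partial_sep_r _ (cst c) a x sg (derivable_cst _ _ _).
by rewrite partial_cst mulr0.
Qed.

Let Gll i j y : G y (lshift m i) (lshift m j) = u (xi y) * ((i == j)%:R * eps i).
Proof. by rewrite /G block_mxEul !mxE. Qed.
Let Glr i b y : G y (lshift m i) (rshift n b) = 0.
Proof. by rewrite /G block_mxEur mxE. Qed.
Let Grl i b y : G y (rshift n b) (lshift m i) = 0.
Proof. by rewrite /G block_mxEdl mxE. Qed.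
Let Grr a b y : G y (rshift n a) (rshift n b) = w (xi y) * H (rsubmx y) a b.
Proof. by rewrite /G block_mxEdr mxE. Qed.

Let dGll_l k i j x : partial (fun y => G y (lshift m i) (lshift m j)) (lshift m k) x =
  alpha k * u^`()%classic (xi x) * ((i == j)%:R * eps i).
Proof. by under eq_fun do rewrite Gll; exact: partial_xi_l. Qed.
Let dGll_r c i j x : partial (fun y => G y (lshift m i) (lshift m j)) (rshift n c) x = 0.
Proof. by under eq_fun do rewrite Gll; exact: partial_xi_r. Qed.
Let dGlr i b K x : partial (fun y => G y (lshift m i) (rshift n b)) K x = 0.
Proof. by under eq_fun do rewrite Glr; exact: partial_cst. Qed.
Let dGrl i b K x : partial (fun y => G y (rshift n b) (lshift m i)) K x = 0.
Proof. by under eq_fun do rewrite Grl; exact: partial_cst. Qed.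
Let dGrr_l k a b x : partial (fun y => G y (rshift n a) (rshift n b)) (lshift m k) x =
  alpha k * w^`()%classic (xi x) * H (rsubmx x) a b.
Proof.
by under eq_fun do rewrite Grr; exact: (partial_sep_l w (fun z => H z a b) k x sw).
Qed.
Let dGrr_r c a b x : U x ->
  partial (fun y => G y (rshift n a) (rshift n b)) (rshift n c) x =
  w (xi x) * partial (fun z => H z a b) c (rsubmx x).
Proof.
move=> Ux; under eq_fun do rewrite Grr.
apply: (partial_sep_r w (fun z => H z a b) c x sw); exact: dH.
Qed.

Let un0 t : u t != 0. Proof. by rewrite gt_eqF. Qed.
Let wn0 t : w t != 0. Proof. by rewrite gt_eqF. Qed.

Let EE : E *m E = 1%:M.
Proof.
apply/matrixP => i j; rewrite !mxE.
rewrite (eq_bigr (fun l => (i == l)%:R * eps i * eps l * (l == j)%:R)) => [|l _].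
  by rewrite sum_deltar; case: eqVneq => [->|_]; rewrite ?mul0r// mul1r eps2.
by rewrite !mxE; ring.
Qed.

Let invG x : U x -> invmx (G x) =
  block_mx ((u (xi x))^-1 *: E) 0 0 ((w (xi x))^-1 *: invmx (H (rsubmx x))).
Proof.
move=> Ux; have [uE _] := mulmx1_unit EE.
have uE' : u (xi x) *: E \in unitmx by rewrite unitmxZ// unitfE.
have uH : w (xi x) *: H (rsubmx x) \in unitmx.
  by rewrite unitmxZ ?unitfE//; exact: unitH.
rewrite /G invmx_block_diag; last exact: block_diag_unitmx.
have invE : invmx E = E by rewrite -[LHS]mulmx1 -EE mulKmx.
by rewrite !invmxZ// invE.
Qed.

Let inv_ll x k l : U x -> invmx (G x) (lshift m k) (lshift m l) =
  (u (xi x))^-1 * ((k == l)%:R * eps k).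
Proof. by move=> Ux; rewrite invG// block_mxEul !mxE. Qed.
Let inv_lr x k l : U x -> invmx (G x) (lshift m k) (rshift n l) = 0.
Proof. by move=> Ux; rewrite invG// block_mxEur !mxE. Qed.
Let inv_rl x k l : U x -> invmx (G x) (rshift n k) (lshift m l) = 0.
Proof. by move=> Ux; rewrite invG// block_mxEdl !mxE. Qed.
Let inv_rr x k l : U x -> invmx (G x) (rshift n k) (rshift n l) =
  (w (xi x))^-1 * invmx (H (rsubmx x)) k l.
Proof. by move=> Ux; rewrite invG// block_mxEdr !mxE. Qed.

Let Gamma := christoffel G.
Let p t : R := u^`()%classic t / (2 * u t).
Let q t : R := w^`()%classic t / (2 * w t).
Let r t : R := w^`()%classic t / (2 * u t).
Local Notation L := (lshift m).
Local Notation S := (rshift n).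

Lemma chr_lll k i j x : U x -> Gamma (L k) (L i) (L j) x = p (xi x) * conformal_coef eps alpha k i j.
Proof.
move=> Ux; rewrite /Gamma /christoffel big_split_ord/= [X in _ + X]big1 ?addr0; last first.
  by move=> c _; rewrite inv_lr// mul0r.
rewrite (eq_bigr (fun l => (u (xi x))^-1 * eps k * u^`()%classic (xi x) *
   (alpha i * ((j == l)%:R * eps j) + alpha j * ((i == l)%:R * eps i)
    - alpha l * ((i == j)%:R * eps i)) * (l == k)%:R)) => [|l _]; last first.
  by rewrite inv_ll// !dGll_l [l == k]eq_sym; ring.
rewrite sum_deltar /conformal_coef /p [k == j]eq_sym [k == i]eq_sym.
have e1 : (j == k)%:R * eps j = (j == k)%:R * eps k by case: eqVneq => [->//|_]; rewrite !mul0r.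
have e2 : (i == k)%:R * eps i = (i == k)%:R * eps k by case: eqVneq => [->//|_]; rewrite !mul0r.
rewrite e1 e2; field: (eps2 k); exact: un0.
Qed.

Lemma chr_lrr k a b x : U x ->
  Gamma (L k) (S a) (S b) x = - (r (xi x) * (eps k * alpha k)) * H (rsubmx x) a b.
Proof.
move=> Ux; rewrite /Gamma /christoffel big_split_ord/= [X in _ + X]big1 ?addr0; last first.
  by move=> c _; rewrite inv_lr// mul0r.
rewrite (eq_bigr (fun l => - ((u (xi x))^-1 * eps k * alpha l * w^`()%classic (xi x) *
   H (rsubmx x) a b) * (l == k)%:R)) => [|l _]; last first.
  by rewrite inv_ll// !dGrl dGrr_l [l == k]eq_sym; ring.
rewrite sum_deltar /r; field; exact: un0.
Qed.

Lemma chr_llr k i b x : U x -> Gamma (L k) (L i) (S b) x = 0.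
Proof.
move=> Ux; rewrite /Gamma /christoffel big_split_ord/= [X in _ + X]big1 ?addr0; last first.
  by move=> c _; rewrite inv_lr// mul0r.
rewrite big1 ?mulr0// => l _.
by rewrite dGrl dGll_r dGlr !addr0 subrr mulr0.
Qed.

Lemma chr_lrl k i b x : U x -> Gamma (L k) (S b) (L i) x = 0.
Proof.
move=> Ux; rewrite /Gamma /christoffel big_split_ord/= [X in _ + X]big1 ?addr0; last first.
  by move=> c _; rewrite inv_lr// mul0r.
rewrite big1 ?mulr0// => l _.
by rewrite dGrl dGll_r dGrl !addr0 subrr mulr0.
Qed.

Lemma chr_rll c i j x : U x -> Gamma (S c) (L i) (L j) x = 0.
Proof.
move=> Ux; rewrite /Gamma /christoffel big_split_ord/= [X in X + _]big1 ?add0r; last first.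
  by move=> l _; rewrite inv_rl// mul0r.
rewrite big1 ?mulr0// => d _.
by rewrite !dGlr dGll_r !addr0 subrr mulr0.
Qed.

Let invHH x c b : U x -> \sum_d invmx (H (rsubmx x)) c d * H (rsubmx x) d b = (c == b)%:R.
Proof. by move=> Ux; have /matrixP/(_ c b) := mulVmx (unitH _ Ux); rewrite !mxE. Qed.

Let symHx x a b : U x -> H (rsubmx x) a b = H (rsubmx x) b a.
Proof. by move=> Ux; rewrite -[in LHS](symH _ Ux) mxE. Qed.

Lemma chr_rlr c i b x : U x ->
  Gamma (S c) (L i) (S b) x = q (xi x) * (alpha i * (c == b)%:R).
Proof.
move=> Ux; rewrite /Gamma /christoffel big_split_ord/= [X in X + _]big1 ?add0r; last first.
  by move=> l _; rewrite inv_rl// mul0r.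
rewrite (eq_bigr (fun d => (w (xi x))^-1 * (alpha i * w^`()%classic (xi x)) *
    (invmx (H (rsubmx x)) c d * H (rsubmx x) d b))) => [|d _]; last first.
  by rewrite inv_rr// dGrr_l !dGlr (symHx x b d Ux); ring.
rewrite -mulr_sumr invHH// /q; field; exact: wn0.
Qed.

Lemma chr_rrl c i b x : U x ->
  Gamma (S c) (S b) (L i) x = q (xi x) * (alpha i * (c == b)%:R).
Proof.
move=> Ux; rewrite -chr_rlr// /Gamma; apply: (christoffel_sym U) => // y Vy.
have uE : E^T = E.
  by apply/matrixP => i' j'; rewrite !mxE eq_sym; case: eqVneq => [->//|_]; rewrite !mul0r.
by rewrite /G tr_block_mx !trmx0 !linearZ/= uE symH.
Qed.

Lemma chr_rrr c a b x : U x ->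
  Gamma (S c) (S a) (S b) x = christoffel H c a b (rsubmx x).
Proof.
move=> Ux; rewrite /Gamma /christoffel big_split_ord/= [X in X + _]big1 ?add0r; last first.
  by move=> l _; rewrite inv_rl// mul0r.
congr (_ * _); apply: eq_bigr => d _.
rewrite inv_rr// !dGrr_r//; field; exact: wn0.
Qed.


Let smooth_half (g h : R -> R) : smooth_real g -> smooth_real h -> (forall t, 0 < h t) ->
  smooth_real (fun t => g^`()%classic t / (2 * h t)).
Proof.
move=> sg sh h0.
have s2 : smooth_real (cst (2^-1 : R)) by rewrite smooth_realP => k; exact: derivable_upto_cst.
have := smooth_realM _ _ (smooth_realM _ _ s2 (smooth_real_derive1 _ sg)) (smooth_real_inv _ sh h0).
congr smooth_real; apply/funext => t; rewrite !fctE.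
by field; rewrite gt_eqF.
Qed.

Let sp : smooth_real p. Proof. exact: smooth_half. Qed.
Let sq : smooth_real q. Proof. exact: smooth_half. Qed.
Let sr : smooth_real r. Proof. exact: smooth_half. Qed.

Let dchr_lll k i j z x : U x -> partial (Gamma (L k) (L i) (L j)) (L z) x =
  alpha z * p^`()%classic (xi x) * conformal_coef eps alpha k i j.
Proof.
by move=> Ux; rewrite (partial_ext U _ _ _ _ oU (chr_lll k i j) Ux); exact: partial_xi_l.
Qed.

Let dchr_lll_r k i j c x : U x -> partial (Gamma (L k) (L i) (L j)) (S c) x = 0.
Proof.
by move=> Ux; rewrite (partial_ext U _ _ _ _ oU (chr_lll k i j) Ux); exact: partial_xi_r.
Qed.

Let dchr_lrr k a b z x : U x -> partial (Gamma (L k) (S a) (S b)) (L z) x =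
  alpha z * r^`()%classic (xi x) * (- (eps k * alpha k) * H (rsubmx x) a b).
Proof.
move=> Ux; rewrite (partial_ext U _ (fun y => r (xi y) * (- (eps k * alpha k) * H (rsubmx y) a b)) _ _ oU _ Ux).
  exact: (partial_sep_l r (fun y => - (eps k * alpha k) * H y a b) z x sr).
by move=> y Uy; rewrite chr_lrr//; ring.
Qed.

Let dchr_llr k i b Z x : U x -> partial (Gamma (L k) (L i) (S b)) Z x = 0.
Proof.
by move=> Ux; rewrite (partial_ext U _ _ _ _ oU (chr_llr k i b) Ux); exact: partial_cst.
Qed.

Let dchr_lrl k i b Z x : U x -> partial (Gamma (L k) (S b) (L i)) Z x = 0.
Proof.
by move=> Ux; rewrite (partial_ext U _ _ _ _ oU (chr_lrl k i b) Ux); exact: partial_cst.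
Qed.

Let dchr_rll c i j Z x : U x -> partial (Gamma (S c) (L i) (L j)) Z x = 0.
Proof.
by move=> Ux; rewrite (partial_ext U _ _ _ _ oU (chr_rll c i j) Ux); exact: partial_cst.
Qed.

Let dchr_rlr c i b d x : U x -> partial (Gamma (S c) (L i) (S b)) (S d) x = 0.
Proof.
by move=> Ux; rewrite (partial_ext U _ _ _ _ oU (chr_rlr c i b) Ux); exact: partial_xi_r.
Qed.

Let dchr_rrl_r c i b d x : U x -> partial (Gamma (S c) (S b) (L i)) (S d) x = 0.
Proof.
by move=> Ux; rewrite (partial_ext U _ _ _ _ oU (chr_rrl c i b) Ux); exact: partial_xi_r.
Qed.

Let dchr_rrl c i b z x : U x -> partial (Gamma (S c) (S b) (L i)) (L z) x =
  alpha z * q^`()%classic (xi x) * (alpha i * (c == b)%:R).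
Proof.
by move=> Ux; rewrite (partial_ext U _ _ _ _ oU (chr_rrl c i b) Ux); exact: partial_xi_l.
Qed.

Let dchr_rrr_l c a b z x : U x -> partial (Gamma (S c) (S a) (S b)) (L z) x = 0.
Proof.
by move=> Ux; rewrite (partial_ext U _ _ _ _ oU (chr_rrr c a b) Ux); exact: partial_rsubmx_l.
Qed.

Let dchr_rrr c a b d x : U x -> partial (Gamma (S c) (S a) (S b)) (S d) x =
  partial (christoffel H c a b) d (rsubmx x).
Proof.
by move=> Ux; rewrite (partial_ext U _ _ _ _ oU (chr_rrr c a b) Ux); exact: partial_rsubmx_r.
Qed.

Let trace_l k x : U x -> \sum_I Gamma I I (L k) x =
  (n%:R * p (xi x) + m%:R * q (xi x)) * alpha k.
Proof.
move=> Ux; rewrite big_split_ord/=.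
under eq_bigr do rewrite chr_lll//.
under [X in _ + X]eq_bigr do rewrite chr_rrl// eqxx mulr1.
by rewrite -mulr_sumr conformal_coef_trace// sumr_const card_ord -mulr_natl; ring.
Qed.

Let trace_r b x : U x -> \sum_I Gamma I I (S b) x =
  \sum_c christoffel H c c b (rsubmx x).
Proof.
move=> Ux; rewrite big_split_ord/= big1 ?add0r; last by move=> i _; exact: chr_llr.
by apply: eq_bigr => c _; exact: chr_rrr.
Qed.

(** The left-hand side is the factor of alpha_j alpha_k in the base components of
    the Ricci tensor; for u = 1 / phi^2 and w = f^2 the equation is the
    differential equation for phi, divided by phi f. *)
Hypothesis wave : forall t,
  (2 - n%:R) * p^`()%classic t - m%:R * q^`()%classic t
  + 2 * p t * (n%:R * p t + m%:R * q t) - (n%:R + 2) * p t ^+ 2 - m%:R * q t ^+ 2 = 0.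

Lemma ricci_ll j k x : U x -> ricci G (L j) (L k) x = 0.
Proof.
move=> Ux; rewrite ricciE -/Gamma.
rewrite [X in X - _ + _ - _](_ : _ = 2 * p^`()%classic (xi x) * alpha j * alpha k); last first.
  rewrite big_split_ord/= [X in _ + X]big1 ?addr0; last by move=> c _; exact: dchr_rll.
  rewrite (eq_bigr (fun i => p^`()%classic (xi x) * (alpha i * conformal_coef eps alpha i j k))); last first.
    by move=> i _; rewrite dchr_lll//; ring.
  by rewrite -mulr_sumr conformal_coef_div//; ring.
rewrite [X in _ - X + _ - _](_ : _ =
    (n%:R * p^`()%classic (xi x) + m%:R * q^`()%classic (xi x)) * alpha j * alpha k); last first.
  rewrite big_split_ord/=.
  under eq_bigr do rewrite dchr_lll//.
  under [X in _ + X]eq_bigr do rewrite dchr_rrl// eqxx mulr1.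
  by rewrite -mulr_sumr conformal_coef_trace// sumr_const card_ord -mulr_natl; ring.
rewrite [X in _ + X - _](_ : _ =
    2 * p (xi x) * (n%:R * p (xi x) + m%:R * q (xi x)) * alpha j * alpha k); last first.
  rewrite big_split_ord/= [X in _ + X]big1 ?addr0; last by move=> c _; rewrite chr_rll// mul0r.
  rewrite (eq_bigr (fun i => p (xi x) * (n%:R * p (xi x) + m%:R * q (xi x)) *
      (alpha i * conformal_coef eps alpha i j k))); last first.
    by move=> i _; rewrite trace_l// chr_lll//; ring.
  by rewrite -mulr_sumr conformal_coef_div//; ring.
rewrite [X in _ - X = _](_ : _ =
    ((n%:R + 2) * p (xi x) ^+ 2 + m%:R * q (xi x) ^+ 2) * alpha j * alpha k).
  rewrite -[RHS](mul0r (alpha j * alpha k)) -(wave (xi x)); ring.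
rewrite big_split_ord/=.
rewrite (eq_bigr (fun i => p (xi x) ^+ 2 * \sum_l conformal_coef eps alpha l i k * conformal_coef eps alpha i j l)); last first.
  move=> i _; rewrite big_split_ord/= [X in _ + X]big1 ?addr0; last first.
    by move=> c _; rewrite chr_rll// mul0r.
  by rewrite mulr_sumr; apply: eq_bigr => l _; rewrite !chr_lll//; ring.
rewrite -mulr_sumr conformal_coef_quad// (eq_bigr (fun=> q (xi x) ^+ 2 * alpha j * alpha k)); last first.
  move=> c _; rewrite big_split_ord/= [X in X + _]big1 ?add0r; last first.
    by move=> l _; rewrite chr_lrl// mul0r.
  rewrite (eq_bigr (fun d => q (xi x) ^+ 2 * alpha j * alpha k * (c == d)%:R * (d == c)%:R)); last first.
    by move=> d _; rewrite chr_rrl// chr_rlr//; ring.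
  by rewrite sum_deltar eqxx mulr1.
by rewrite sumr_const card_ord -mulr_natl; ring.
Qed.

(** Each mixed term carries the factor sum_i alpha_i eps_i alpha_i = 0. *)
Lemma ricci_rr a b x : U x -> ricci G (S a) (S b) x = ricci H a b (rsubmx x).
Proof.
move=> Ux; rewrite !ricciE -/Gamma; congr (_ - _ + _ - _).
- rewrite big_split_ord/= (eq_bigr (fun i => - (r^`()%classic (xi x) * H (rsubmx x) a b) *
      (alpha i * (eps i * alpha i)))); last by move=> i _; rewrite dchr_lrr//; ring.
  rewrite -mulr_sumr null_contraction// mulr0 add0r.
  by apply: eq_bigr => c _; rewrite dchr_rrr.
- rewrite big_split_ord/= big1 ?add0r; last by move=> i _; exact: dchr_llr.
  by apply: eq_bigr => c _; rewrite dchr_rrr.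
- rewrite big_split_ord/= (eq_bigr (fun i => - (r (xi x) * H (rsubmx x) a b *
      (n%:R * p (xi x) + m%:R * q (xi x))) * (alpha i * (eps i * alpha i)))); last first.
    by move=> i _; rewrite chr_lrr// trace_l//; ring.
  rewrite -mulr_sumr null_contraction// mulr0 add0r.
  by apply: eq_bigr => c _; rewrite chr_rrr// trace_r.
- rewrite big_split_ord/= [X in X + _](_ : _ = 0) ?add0r.
    apply: eq_bigr => c _; rewrite big_split_ord/=.
    rewrite (eq_bigr (fun i => - (q (xi x) * r (xi x) * H (rsubmx x) c b * (c == a)%:R) *
      (alpha i * (eps i * alpha i)))); last first.
      by move=> i _; rewrite chr_lrr// chr_rrl//; ring.
    rewrite -mulr_sumr null_contraction// mulr0 add0r.
    by apply: eq_bigr => d _; rewrite !chr_rrr.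
  rewrite (eq_bigr (fun i => - (q (xi x) * r (xi x) * H (rsubmx x) a b) *
      (alpha i * (eps i * alpha i)))); last first.
    move=> i _; rewrite big_split_ord/= [X in X + _]big1 ?add0r; last first.
      by move=> l _; rewrite chr_llr// mul0r.
    rewrite (eq_bigr (fun c => - (q (xi x) * r (xi x) * H (rsubmx x) a c) *
      (alpha i * (eps i * alpha i)) * (c == b)%:R)); last first.
      by move=> c _; rewrite chr_rlr// chr_lrr//; ring.
    by rewrite sum_deltar.
  by rewrite -mulr_sumr null_contraction// mulr0.
Qed.

(** The two remaining terms are both q alpha_j times the trace of the Christoffel
    symbols of [H], with opposite signs. *)
Lemma ricci_lr j b x : U x -> ricci G (L j) (S b) x = 0.
Proof.
move=> Ux; rewrite ricciE -/Gamma.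
rewrite [X in X - _ + _ - _](_ : _ = 0); last first.
  rewrite big_split_ord/= !big1 ?addr0//; last by move=> i _; exact: dchr_llr.
  by move=> c _; exact: dchr_rlr.
rewrite [X in _ - X + _ - _](_ : _ = 0); last first.
  rewrite big_split_ord/= !big1 ?addr0//; last by move=> i _; exact: dchr_llr.
  by move=> c _; exact: dchr_rrr_l.
rewrite [X in _ + X - _](_ : _ = q (xi x) * alpha j * \sum_c christoffel H c c b (rsubmx x)); last first.
  rewrite big_split_ord/= big1 ?add0r; last by move=> i _; rewrite chr_llr// mul0r.
  rewrite (eq_bigr (fun c => q (xi x) * alpha j *
    (\sum_d christoffel H d d c (rsubmx x)) * (c == b)%:R)); last first.
    by move=> c _; rewrite chr_rlr// trace_r//; ring.
  by rewrite sum_deltar.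
rewrite subr0 add0r; apply/eqP; rewrite subr_eq0; apply/eqP; symmetry.
rewrite big_split_ord/= [X in X + _]big1 ?add0r; last first.
  move=> i _; rewrite big_split_ord/= !big1 ?addr0//.
    by move=> c _; rewrite [X in _ * X]chr_llr// mulr0.
  by move=> l _; rewrite chr_llr// mul0r.
rewrite mulr_sumr; apply: eq_bigr => c _.
rewrite big_split_ord/= [X in X + _]big1 ?add0r; last first.
  by move=> l _; rewrite [X in _ * X]chr_rll// mulr0.
rewrite (eq_bigr (fun d => q (xi x) * alpha j * christoffel H d c b (rsubmx x) * (d == c)%:R)); last first.
  by move=> d _; rewrite chr_rrr// chr_rlr// eq_sym; ring.
by rewrite sum_deltar.
Qed.

Lemma ricci_rl k b x : U x -> ricci G (S b) (L k) x = 0.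
Proof.
move=> Ux; rewrite ricciE -/Gamma.
rewrite [X in X - _ + _ - _](_ : _ = 0); last first.
  rewrite big_split_ord/= !big1 ?addr0//; last by move=> i _; exact: dchr_lrl.
  by move=> c _; exact: dchr_rrl_r.
rewrite [X in _ - X + _ - _](_ : _ = 0); last first.
  rewrite big_split_ord/= !big1 ?addr0//; last by move=> i _; exact: dchr_lll_r.
  by move=> c _; exact: dchr_rrl_r.
rewrite [X in _ + X - _](_ : _ = q (xi x) * alpha k * \sum_c christoffel H c c b (rsubmx x)); last first.
  rewrite big_split_ord/= big1 ?add0r; last by move=> i _; rewrite chr_lrl// mul0r.
  rewrite (eq_bigr (fun c => q (xi x) * alpha k *
    (\sum_d christoffel H d d c (rsubmx x)) * (c == b)%:R)); last first.
    by move=> c _; rewrite chr_rrl// trace_r//; ring.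
  by rewrite sum_deltar.
rewrite subr0 add0r; apply/eqP; rewrite subr_eq0; apply/eqP; symmetry.
rewrite big_split_ord/= [X in X + _]big1 ?add0r; last first.
  move=> i _; rewrite big_split_ord/= !big1 ?addr0//.
    by move=> c _; rewrite chr_rll// mul0r.
  by move=> l _; rewrite [X in _ * X]chr_lrl// mulr0.
rewrite mulr_sumr; apply: eq_bigr => c _.
rewrite big_split_ord/= [X in X + _]big1 ?add0r; last first.
  by move=> l _; rewrite chr_lrl// mul0r.
rewrite (eq_bigr (fun d => q (xi x) * alpha k * christoffel H c b d (rsubmx x) * (d == c)%:R)); last first.
  by move=> d _; rewrite chr_rrl// chr_rrr//; ring.
by rewrite sum_deltar (christoffel_sym V).
Qed.

Theorem ricci_flat_warped : (forall y, V y -> forall a b, ricci H a b y = 0) ->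
  forall x, V (rsubmx x) -> forall I J, ricci G I J x = 0.
Proof.
move=> flatH x Ux I J.
case: (split_ordP I) => i ->; case: (split_ordP J) => j ->.
- exact: ricci_ll.
- exact: ricci_lr.
- exact: ricci_rl.
- by rewrite ricci_rr//; exact: flatH.
Qed.

End warped_wave_metric.

(** * Ricci-flat warped products over null functions *)

Theorem theorem1p5 (R : realType) (n m : nat) (hn : (3 <= n)%N) (hm : (1 <= m)%N)
  (eps : 'I_n -> R) (heps : forall i, eps i = 1 \/ eps i = -1)
  (F : charted_space R m) (gF : tensor02 F)
  (hF : semi_riemannian gF) (hFflat : ricci_flat gF)
  (alpha : 'I_n -> R) (halpha : exists i, alpha i != 0)
  (hnull : \sum_(i < n) eps i * alpha i ^+ 2 = 0)
  (f : R -> R) (hf : smooth_real f) (hfpos : forall t, 0 < f t) :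
  exists phi : R -> R,
    [/\ smooth_real phi,
        forall t, phi t != 0,
        forall t, (n - 2)%:R * f t * phi^`(2)%classic t - m%:R * phi t * f^`(2)%classic t
                  - 2 * m%:R * phi^`()%classic t * f^`()%classic t = 0 &
        let gbar := scale_metric
          (fun x : carrier (euclidean_space R n) =>
             1 / phi (linear_form alpha x) ^+ 2)
          (pseudo_euclidean eps) in
        let gM := warped_metric gbar
          (fun x : carrier (euclidean_space R n) => f (linear_form alpha x)) gF in
        semi_riemannian gM /\ ricci_flat gM].
Proof.
have n2 : 0 < (n - 2)%:R :> R by rewrite ltr0n subn_gt0.
have [phi [sphi phi0 ode]] := conformal_factor_exists f _ m%:R hf hfpos n2 (ler0n _ _).
exists phi; split=> // [t|gbar gM]; first by rewrite gt_eqF.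
have su : smooth_real (fun t => 1 / phi t ^+ 2).
  have si := smooth_real_inv _ sphi phi0.
  rewrite (_ : (fun t => _) = (fun s => (phi s)^-1) * (fun s => (phi s)^-1)).
    exact: smooth_realM.
  by apply/funext => t; rewrite !fctE div1r -expr2 exprVn.
have u0 t : 0 < 1 / phi t ^+ 2 by rewrite divr_gt0// exprn_gt0.
have sw : smooth_real (fun t => f t ^+ 2).
  rewrite (_ : (fun t => _) = f * f); first exact: smooth_realM.
  by apply/funext => t; rewrite !fctE expr2.
have w0 t : 0 < f t ^+ 2 by rewrite exprn_gt0.
have eps2 i : eps i * eps i = 1 by case: (heps i) => ->; rewrite ?mulr1// mulrNN mulr1.
have eps0 i : eps i != 0.
  by apply/eqP => e0; have := eps2 i; rewrite e0 mul0r => /eqP; rewrite eq_sym oner_eq0.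
split.
  apply: warped_semi_riemannian => //.
  - apply: scale_semi_riemannian => //; first exact: pseudo_euclidean_semi_riemannian.
    by move=> a; exact: (smooth_on_linear_form alpha _ _ su).
  - by move=> a; exact: (smooth_on_linear_form alpha _ _ hf).
have pE : (fun t => (fun t => 1 / phi t ^+ 2)^`()%classic t / (2 * (1 / phi t ^+ 2))) =
    fun t => - (phi^`()%classic t / phi t).
  by apply/funext => t; rewrite derive1_invsq//; field; rewrite gt_eqF.
have qE : (fun t => (fun t => f t ^+ 2)^`()%classic t / (2 * f t ^+ 2)) =
    fun t => f^`()%classic t / f t.
  by apply/funext => t; rewrite derive1_sq//; field; rewrite gt_eqF.
have [mF tF sF symF ndF _] := hF.
move=> [a b] x /product_chart_image[/= _ bx] I J.
apply: (@ricci_flat_warped R n m eps alpha eps2 hnull _ _ su sw u0 w0 (chart_image b) (gF b)) => //.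
- exact: open_chart_image mF b.
- by move=> c d e y yb; have [_ /(_ e)[+ _]] := sF b c d 1%N; exact.
- exact: symF.
- exact: ndF.
- move=> t.
  have dp : (fun t => - (phi^`()%classic t / phi t))^`()%classic t =
      - (phi^`(2)%classic t / phi t - (phi^`()%classic t / phi t) ^+ 2).
    rewrite -derive1_log//; apply: derive1N; rewrite /=.
    have := smooth_realM _ _ (smooth_real_derive1 _ sphi) (smooth_real_inv _ sphi phi0).
    by move=> /(_ 0%N t).
  rewrite pE qE (congr1 (fun h => h t) pE) (congr1 (fun h => h t) qE) dp derive1_log//.
  have nE : (n - 2)%:R = n%:R - 2 :> R by rewrite natrB// ltnW.
  (* The scalar factor of the Ricci tensor, in terms of phi and f. *)
  have ratE (N M f0 f1 f2 P P1 P2 : R) : f0 != 0 -> P != 0 ->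
      (2 - N) * - (P2 / P - (P1 / P) ^+ 2) - M * (f2 / f0 - (f1 / f0) ^+ 2)
      + 2 * - (P1 / P) * (N * - (P1 / P) + M * (f1 / f0))
      - (N + 2) * (- (P1 / P)) ^+ 2 - M * (f1 / f0) ^+ 2 =
      ((N - 2) * f0 * P2 - M * P * f2 - 2 * M * P1 * f1) / (P * f0).
    by move=> f0n Pn; field; rewrite f0n Pn.
  by rewrite ratE ?gt_eqF// -nE ode mul0r.
- by move=> y yb c d; exact: hFflat.
Qed.
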